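(* Within each of the following chains, all listed quaternary sums are equivalent to one another, and every sum listed is universal over $\mathbb{Z}$: (1) $2p_5+4p_5+p_8+p_8 \sim 4p_3+p_4+2p_5+p_8 \sim 3p_3+4p_3+p_4+p_5 \sim 2p_3+2p_4+p_8+p_8 \sim 3p_3+p_5+4p_5+p_8 \sim p_3+2p_3+3p_3+4p_5$; (2) $3p_4+p_5+2p_5+p_8 \sim p_3+2p_3+3p_4+2p_5 \sim p_3+3p_4+2p_5+6p_5 \sim 3p_3+3p_4+p_5+p_5 \sim p_5+p_5+3p_5+6p_5 \sim p_3+p_5+p_5+6p_5$; (3) $p_5+4p_5+p_8+p_8 \sim p_3+2p_3+4p_5+p_8 \sim p_3+2p_3+4p_3+p_4 \sim 2p_3+4p_3+p_5+2p_5 \sim p_5+2p_5+2p_5+2p_8 \sim p_3+p_4+2p_5+2p_8 \sim 4p_3+p_5+2p_5+6p_5 \sim p_3+4p_3+p_4+6p_5 \sim p_3+4p_5+6p_5+p_8$; (4) $6p_3+p_5+2p_5+2p_5 \sim p_5+2p_5+4p_5+2p_8 \sim p_3+p_4+4p_5+2p_8 \sim 2p_3+2p_4+p_5+2p_8 \sim 2p_3+4p_3+p_5+4p_5 \sim 2p_3+p_5+4p_5+12p_5$; (5) $6p_3+p_5+2p_5+p_8 \sim p_3+2p_3+6p_3+2p_5 \sim p_3+6p_3+2p_5+6p_5 \sim p_3+2p_5+6p_5+18p_5 \sim p_3+2p_3+4p_5+2p_8 \sim p_5+4p_5+p_8+2p_8 \sim 4p_3+p_4+p_5+2p_8$; (6)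 $2p_5+4p_5+p_8+2p_8 \sim 2p_3+2p_4+p_8+2p_8 \sim 2p_3+4p_3+4p_5+p_8 \sim 4p_3+p_4+2p_5+2p_8 \sim 2p_3+4p_5+12p_5+p_8$; (7) $3p_3+3p_4+p_5+p_8 \sim p_5+3p_5+6p_5+p_8 \sim p_3+p_5+6p_5+p_8 \sim p_3+p_3+2p_3+6p_5 \sim 2p_3+2p_3+p_4+6p_5 \sim 4p_3+p_4+2p_4+6p_5 \sim 2p_4+4p_5+6p_5+p_8$; (8) $2p_5+2p_5+p_8+p_8 \sim 3p_3+p_5+2p_5+p_8 \sim 3p_3+3p_3+p_5+p_5 \sim 6p_3+3p_4+p_5+p_5 \sim p_3+3p_3+p_4+p_8 \sim p_3+2p_3+3p_3+2p_5 \sim p_3+3p_3+2p_5+6p_5$; (9) $3p_3+6p_3+p_5+2p_5 \sim p_5+2p_5+3p_5+3p_8 \sim p_3+p_4+3p_5+3p_8$; (10) $6p_3+3p_4+2p_5+p_8 \sim 3p_4+4p_5+p_8+2p_8 \sim 4p_3+p_4+3p_4+2p_8$; (11) $4p_5+p_8+2p_8+3p_8 \sim 4p_3+p_4+2p_8+3p_8$; (12) $4p_5+p_8+p_8+2p_8 \sim 4p_3+p_4+p_8+2p_8$; (13) $2p_5+p_8+2p_8+2p_8 \sim 2p_3+4p_3+p_8+2p_8$; (14) $p_5+2p_5+4p_5+p_8 \sim 4p_3+p_4+p_5+2p_5$; (15) $p_5+p_8+p_8+2p_8 \sim p_3+2p_3+p_8+2p_8$; (16) $4p_5+p_8+2p_8+5p_8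 \sim 4p_3+p_4+2p_8+5p_8$; (17) $4p_5+p_8+p_8+3p_8 \sim 4p_3+p_4+p_8+3p_8$; (18) $4p_5+p_8+p_8+p_8 \sim 4p_3+p_4+p_8+p_8$; (19) $2p_5+p_8+p_8+2p_8 \sim 2p_3+4p_3+p_8+p_8$; (20) $3p_3+p_5+p_8+2p_8 \sim p_3+2p_3+3p_3+2p_8$; (21) $4p_5+p_8+2p_8+2p_8 \sim 4p_3+p_4+2p_8+2p_8$; (22) $6p_3+p_5+p_5+2p_5 \sim p_5+p_5+4p_5+2p_8$; (23) $p_3+2p_5+4p_5+6p_5 \sim p_3+2p_3+2p_4+6p_5$; (24) $p_5+4p_5+p_8+p_8 \sim 4p_3+p_4+p_5+p_8$; (25) $4p_5+p_8+2p_8+6p_8 \sim 4p_3+p_4+2p_8+6p_8$; (26) $p_3+6p_3+p_4+p_5 \sim 6p_3+p_4+p_5+3p_5$.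
   Context: For an integer $m\ge 3$ and $x\in\mathbb{Z}$, the generalized $m$-gonal number is $p_m(x)=\frac{(m-2)x^2-(m-4)x}{2}$; thus $p_3(x)=x(x+1)/2$, $p_4(x)=x^2$, $p_5(x)=x(3x-1)/2$, $p_8(x)=x(3x-2)$. For positive integers $a,b,c,d$ and $r,s,t,u\ge 3$, the notation $ap_r+bp_s+cp_t+dp_u$ denotes the function $(h,l,m,n)\mapsto ap_r(h)+bp_s(l)+cp_t(m)+dp_u(n)$ on $\mathbb{Z}^4$ (four independent integer variables). Such a sum is called universal over $\mathbb{Z}$ if its set of values $\{ap_r(h)+bp_s(l)+cp_t(m)+dp_u(n): h,l,m,n\in\mathbb{Z}\}$ equals $\mathbb{N}_0=\{0,1,2,\dots\}$. Two such sums $F$ and $G$ are called equivalent, written $F\sim G$, if their sets of values over $\mathbb{Z}^4$ coincide. *)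

(* Defs.v *)
From Stdlib Require Import ZArith List.
Import ListNotations.
Open Scope Z_scope.

(* generalized m-gonal number p_m(x) = ((m-2)x^2 - (m-4)x)/2 ; the numerator
   is always even, so Z.div is exact. *)
Definition pgon (m x : Z) : Z := ((m - 2) * x * x - (m - 4) * x) / 2.

Record qsum := Q { ca : Z; ra : Z; cb : Z; rb : Z; cc : Z; rc : Z; cd : Z; rd : Z }.

Definition qeval (F : qsum) (h l m n : Z) : Z :=
  ca F * pgon (ra F) h + cb F * pgon (rb F) l + cc F * pgon (rc F) m + cd F * pgon (rd F) n.

Definition represents (F : qsum) (N : Z) : Prop :=
  exists h l m n : Z, qeval F h l m n = N.

Definition universal (F : qsum) : Prop := forall N : Z, represents F N <-> 0 <= N.

Definition equivalent (F G : qsum) : Prop := forall N : Z, represents F N <-> represents G N.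

Definition chains : list (list qsum) := [
 (* 1 *) [Q 2 5 4 5 1 8 1 8; Q 4 3 1 4 2 5 1 8; Q 3 3 4 3 1 4 1 5; Q 2 3 2 4 1 8 1 8;
          Q 3 3 1 5 4 5 1 8; Q 1 3 2 3 3 3 4 5];
 (* 2 *) [Q 3 4 1 5 2 5 1 8; Q 1 3 2 3 3 4 2 5; Q 1 3 3 4 2 5 6 5; Q 3 3 3 4 1 5 1 5;
          Q 1 5 1 5 3 5 6 5; Q 1 3 1 5 1 5 6 5];
 (* 3 *) [Q 1 5 4 5 1 8 1 8; Q 1 3 2 3 4 5 1 8; Q 1 3 2 3 4 3 1 4; Q 2 3 4 3 1 5 2 5;
          Q 1 5 2 5 2 5 2 8; Q 1 3 1 4 2 5 2 8; Q 4 3 1 5 2 5 6 5; Q 1 3 4 3 1 4 6 5;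
          Q 1 3 4 5 6 5 1 8];
 (* 4 *) [Q 6 3 1 5 2 5 2 5; Q 1 5 2 5 4 5 2 8; Q 1 3 1 4 4 5 2 8; Q 2 3 2 4 1 5 2 8;
          Q 2 3 4 3 1 5 4 5; Q 2 3 1 5 4 5 12 5];
 (* 5 *) [Q 6 3 1 5 2 5 1 8; Q 1 3 2 3 6 3 2 5; Q 1 3 6 3 2 5 6 5; Q 1 3 2 5 6 5 18 5;
          Q 1 3 2 3 4 5 2 8; Q 1 5 4 5 1 8 2 8; Q 4 3 1 4 1 5 2 8];
 (* 6 *) [Q 2 5 4 5 1 8 2 8; Q 2 3 2 4 1 8 2 8; Q 2 3 4 3 4 5 1 8; Q 4 3 1 4 2 5 2 8;
          Q 2 3 4 5 12 5 1 8];
 (* 7 *) [Q 3 3 3 4 1 5 1 8; Q 1 5 3 5 6 5 1 8; Q 1 3 1 5 6 5 1 8; Q 1 3 1 3 2 3 6 5;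
          Q 2 3 2 3 1 4 6 5; Q 4 3 1 4 2 4 6 5; Q 2 4 4 5 6 5 1 8];
 (* 8 *) [Q 2 5 2 5 1 8 1 8; Q 3 3 1 5 2 5 1 8; Q 3 3 3 3 1 5 1 5; Q 6 3 3 4 1 5 1 5;
          Q 1 3 3 3 1 4 1 8; Q 1 3 2 3 3 3 2 5; Q 1 3 3 3 2 5 6 5];
 (* 9 *) [Q 3 3 6 3 1 5 2 5; Q 1 5 2 5 3 5 3 8; Q 1 3 1 4 3 5 3 8];
 (* 10 *) [Q 6 3 3 4 2 5 1 8; Q 3 4 4 5 1 8 2 8; Q 4 3 1 4 3 4 2 8];
 (* 11 *) [Q 4 5 1 8 2 8 3 8; Q 4 3 1 4 2 8 3 8];
 (* 12 *) [Q 4 5 1 8 1 8 2 8; Q 4 3 1 4 1 8 2 8];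
 (* 13 *) [Q 2 5 1 8 2 8 2 8; Q 2 3 4 3 1 8 2 8];
 (* 14 *) [Q 1 5 2 5 4 5 1 8; Q 4 3 1 4 1 5 2 5];
 (* 15 *) [Q 1 5 1 8 1 8 2 8; Q 1 3 2 3 1 8 2 8];
 (* 16 *) [Q 4 5 1 8 2 8 5 8; Q 4 3 1 4 2 8 5 8];
 (* 17 *) [Q 4 5 1 8 1 8 3 8; Q 4 3 1 4 1 8 3 8];
 (* 18 *) [Q 4 5 1 8 1 8 1 8; Q 4 3 1 4 1 8 1 8];
 (* 19 *) [Q 2 5 1 8 1 8 2 8; Q 2 3 4 3 1 8 1 8];
 (* 20 *) [Q 3 3 1 5 1 8 2 8; Q 1 3 2 3 3 3 2 8];
 (* 21 *) [Q 4 5 1 8 2 8 2 8; Q 4 3 1 4 2 8 2 8];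
 (* 22 *) [Q 6 3 1 5 1 5 2 5; Q 1 5 1 5 4 5 2 8];
 (* 23 *) [Q 1 3 2 5 4 5 6 5; Q 1 3 2 3 2 4 6 5];
 (* 24 *) [Q 1 5 4 5 1 8 1 8; Q 4 3 1 4 1 5 1 8];
 (* 25 *) [Q 4 5 1 8 2 8 6 8; Q 4 3 1 4 2 8 6 8];
 (* 26 *) [Q 1 3 6 3 1 4 1 5; Q 6 3 1 4 1 5 3 5]
].

(* Main.v *)
(** Completing squares turns each of the sums into a diagonal quaternary quadratic form with
    conditions modulo 2 and 3 on the variables. Within a chain one passes from a sum to another by
    replacing two of its terms, for instance [p_5 + p_8] by [p_3 + 2 p_3]; these replacements come
    from factorizations in [Z[i]], [Z[sqrt -2]] and [Z[(1 + sqrt -3)/2]]. For one sum in each chain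
    a suitable choice of one variable reduces universality to the representation by three squares
    of a number congruent to 1 or 2 modulo 4 or to 3 modulo 8, where the conditions modulo 3 are
    met by rotations with denominator 3 and by changes of sign.

    The three squares theorem is proved without primes in arithmetic progressions. A unimodular
    positive ternary form representing [n] is available once [- n] is a square modulo some [D > 0]
    with [D m^2 = - 1] modulo [n]. With [chi] the quadratic character attached to [- n], it is
    enough to find [d] in a prescribed residue class (up to a factor 2) with positive sum of
    [chi e] over the divisors [e] of [d]: then [d = D m^2] with [D] a product of primes [q] such
    that [chi q = 1]. If there were no such [d], the hyperbola method would force [L(1, chi) = 0],
    which the squares [d] contradict. *)
From mathcomp Require Import all_boot all_order all_algebra zify ring lra.
Set Implicit Arguments. Unset Strict Implicit. Unset Printing Implicit Defensive.
Import Order.TTheory GRing.Theory Num.Theory.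

(** * The Schering symbol and quadratic reciprocity *)

(** The usual proof of the three squares theorem takes [m = 1] and a prime, or twice a prime, for
    [D], whence its need for Dirichlet's theorem. Admitting a factor [m ^ 2] weakens the demand to
    positivity of a multiplicative function: at [q ^ k] the divisor sum of [chi] is 1, [k + 1], or
    the indicator that [k] is even. So it is never negative, is at least 1 at squares, and its
    positivity at [d] allows primes with [chi q = -1] only to even exponents. No limit is formed:
    [L(1, chi)] occurs only through its partial sum up to [Y], and all bounds are inequalities
    between rationals with explicit parameters. Equivalence needs no argument of its own, since all
    sums of a chain have the same value set once they are universal. The replacements serve only to
    transport universality, and the chains are checked by computation from a short list of universal
    sums. *)

Definition flip n a k : bool := n./2 < (a * k) %% n.
Definition absres n a k := let r := (a * k) %% n in if n./2 < r then n - r else r.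
(* Schering's form of Gauss's lemma: for odd [n] coprime to [a], [(-1) ^ sch a n] is the
   Jacobi symbol (a/n), with no need to factor [n]. *)
Definition sch a n : bool := odd (\sum_(1 <= k < n./2.+1) flip n a k).

Lemma absres_bound n a k : odd n -> coprime a n -> 0 < k <= n./2 ->
  0 < absres n a k <= n./2.
Proof.
move=> on can hk; rewrite /absres.
have n0 : 0 < n by case: n on {can hk}.
have h1 := ltn_pmod (a * k) n0.
have h2 : 0 < (a * k) %% n.
  rewrite lt0n; apply/negP => /eqP h.
  have : n %| a * k by rewrite /dvdn h.
  rewrite Gauss_dvdr 1?coprime_sym // => /dvdn_leq; lia.
case: ifP; lia.
Qed.

Lemma absres_inj n a : odd n -> coprime a n ->
  {in index_iota 1 n./2.+1 &, injective (absres n a)}.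
Proof.
move=> on can k l; rewrite !mem_index_iota => hk hl; rewrite /absres => h.
have n0 : 0 < n by case: n on {can hk hl h}.
have h1 := ltn_pmod (a * k) n0; have h2 := ltn_pmod (a * l) n0.
have cna : coprime n a by rewrite coprime_sym.
have [e|e] : (a * k) %% n = (a * l) %% n \/ (a * k) %% n + (a * l) %% n = n.
  by move: h; do 2 case: ifP; lia.
- wlog kl : k l hk hl e {h h1 h2} / k <= l.
    move=> W; case: (leqP k l) => [kl|/ltnW lk]; first exact: W.
    by apply/esym; apply: W.
  have : n %| a * l - a * k by rewrite -eqn_mod_dvd ?leq_mul2l ?kl ?orbT //; apply/eqP.
  rewrite -mulnBr Gauss_dvdr // => /dvdnP [[|c] hc]; first lia.
  have : n <= l - k by rewrite hc mulSn leq_addr.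
  lia.
- have : n %| a * k + a * l by rewrite /dvdn -modnDm e modnn.
  rewrite -mulnDr Gauss_dvdr // => /dvdn_leq; lia.
Qed.

Lemma absres_perm n a : odd n -> coprime a n ->
  perm_eq (map (absres n a) (index_iota 1 n./2.+1)) (index_iota 1 n./2.+1).
Proof.
move=> on can; apply: uniq_perm; rewrite ?iota_uniq //.
  by rewrite map_inj_in_uniq ?iota_uniq //; exact: absres_inj.
have sub : {subset map (absres n a) (index_iota 1 n./2.+1) <= index_iota 1 n./2.+1}.
  move=> x /mapP[k]; rewrite !mem_index_iota => hk ->.
  by rewrite ltnS; apply: absres_bound => //; lia.
have [] := @uniq_min_size _ (map (absres n a) (index_iota 1 n./2.+1)) (index_iota 1 n./2.+1).
- by rewrite map_inj_in_uniq ?iota_uniq //; exact: absres_inj.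
- exact: sub.
- by rewrite size_map.
- by move=> _.
Qed.

Lemma sch_modl a n : sch (a %% n) n = sch a n.
Proof. by rewrite /sch /flip; under eq_bigr do rewrite modnMml. Qed.

Lemma odd_sum (I : Type) (r : seq I) (P : pred I) (F : I -> nat) :
  odd (\sum_(i <- r | P i) F i) = \big[addb/false]_(i <- r | P i) odd (F i).
Proof. exact: (big_morph odd oddD). Qed.

(** Reindexing the sum for [a] by the permutation [absres n b] compares both sides term by term:
    negating an argument modulo [n] exchanges the two halves of the residues, so a flip by [b]
    toggles the flip by [a]. *)
Lemma schM a b n : odd n -> coprime a n -> coprime b n ->
  sch (a * b) n = sch a n (+) sch b n.
Proof.
move=> on can cbn.
have n0 : 0 < n by case: n on {can cbn}.
rewrite /sch !odd_sum.
rewrite -[X in _ = X (+) _](perm_big _ (absres_perm on cbn)) big_map -big_split /=.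
rewrite !big_seq; apply: eq_bigr => k; rewrite mem_index_iota => hk.
have /(absres_bound on cbn) hb : 0 < k <= n./2 by lia.
have /(absres_bound on can) : 0 < absres n b k <= n./2 by lia.
rewrite !oddb /flip -mulnA -modnMmr.
move: hb; rewrite /absres; have h1 := ltn_pmod (b * k) n0.
set r := (b * k) %% n in h1 *.
case: (ltnP n./2 r) => hr; last by rewrite addbF.
rewrite addbT => hb ha.
have h2 := ltn_pmod (a * r) n0; have h3 := ltn_pmod (a * (n - r)) n0.
have : (a * r) %% n + (a * (n - r)) %% n = n.
  have : n %| (a * r) %% n + (a * (n - r)) %% n.
    by rewrite /dvdn modnDm -mulnDr subnKC ?modnMl // ltnW.
  move: ha; set u := (a * (n - r)) %% n in h3 *; set v := (a * r) %% n in h2 *.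
  move=> ha /dvdnP[[|[|c]] hc]; [|lia|].
    by move: ha; case: ifP; lia.
  have : 2 * n <= u + v by rewrite addnC hc leq_mul2r; lia.
  lia.
lia.
Qed.

Lemma sch_neg1 n : odd n -> sch n.-1 n = odd n./2.
Proof.
move=> on; rewrite /sch.
have -> : \sum_(1 <= k < n./2.+1) flip n n.-1 k = \sum_(1 <= k < n./2.+1) 1.
  rewrite !big_seq; apply: eq_bigr => k; rewrite mem_index_iota => hk.
  rewrite /flip.
  have -> : n.-1 * k = k.-1 * n + (n - k) by nia.
  rewrite modnMDl modn_small; lia.
by rewrite sum_nat_const_nat muln1 subn1.
Qed.

Lemma sch_2 n : odd n -> sch 2 n = odd (uphalf n./2).
Proof.
move=> on; rewrite /sch.
have -> : \sum_(1 <= k < n./2.+1) flip n 2 k = uphalf n./2; last by [].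
transitivity (\sum_(1 <= k < n./2.+1) (n./2 < 2 * k)).
  rewrite !big_seq; apply: eq_bigr => k; rewrite mem_index_iota => hk.
  by rewrite /flip modn_small //; lia.
move: n./2 => h {on n}.
rewrite (@big_cat_nat _ _ _ h./2.+1) /=; [|lia|lia].
rewrite big_nat big1 ?add0n; last by move=> i hi; apply/eqP; rewrite eqb0; lia.
rewrite big_nat (eq_bigr (fun _ => 1)); last by move=> i hi; apply/eqP; rewrite eqb1; lia.
rewrite -big_nat sum_nat_const_nat; lia.
Qed.

(** Eisenstein's step: in [a k = q n + r] with [a] and [n] odd, [k] has the parity of [q + r], and
    [r] that of [absres] plus the flip; the sums of [k] and of [absres] agree by the permutation. *)
Lemma sch_floor a n : odd n -> odd a -> coprime a n ->
  sch a n = odd (\sum_(1 <= k < n./2.+1) (a * k) %/ n).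
Proof.
move=> on oa can.
have n0 : 0 < n by case: n on {can}.
have : odd (\sum_(1 <= k < n./2.+1) k) = odd (\sum_(1 <= k < n./2.+1) absres n a k).
  by rewrite !odd_sum -(perm_big _ (absres_perm on can)) big_map.
rewrite /sch !odd_sum => e.
have C : \big[addb/false]_(1 <= i < n./2.+1) odd (flip n a i) (+)
         \big[addb/false]_(1 <= i < n./2.+1) odd (a * i %/ n) =
         \big[addb/false]_(1 <= i < n./2.+1) odd i (+)
         \big[addb/false]_(1 <= i < n./2.+1) odd (absres n a i).
  rewrite -!big_split /= !big_seq; apply: eq_bigr => k; rewrite mem_index_iota => hk.
  have := divn_eq (a * k) n; rewrite /flip /absres.
  have h1 := ltn_pmod (a * k) n0.
  move: (a * k %/ n) ((a * k) %% n) h1 => q r h1 /(congr1 odd).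
  rewrite oddM oddD oddM oa on /= andbT => ->.
  by case: ifP => hr /=; rewrite ?(oddB (ltnW h1)) ?on /=; case: (odd q); case: (odd r).
by move: C; rewrite e addbb; case: (\big[_/_]_(_ <= _ < _) _); case: (\big[_/_]_(_ <= _ < _) _).
Qed.

Lemma floor_count a n k : odd n -> odd a -> coprime a n -> 0 < k <= n./2 ->
  (a * k) %/ n = \sum_(1 <= j < a./2.+1) (n * j < a * k).
Proof.
move=> on oa can hk.
have n0 : 0 < n by case: n on {can hk}.
have hq : (a * k) %/ n <= a./2.
  rewrite -ltnS ltn_divLR //.
  have en : n = 2 * n./2 + 1 by lia.
  have ea : a = 2 * a./2 + 1 by lia.
  move: n./2 a./2 hk en ea => h h' /andP[_ hk] en ea.
  have := leq_mul2l a k h; rewrite hk orbT => hh; subst a n; clear - hh. nia.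
rewrite (@big_cat_nat _ _ _ ((a * k) %/ n).+1) //=.
rewrite [X in _ + X]big_nat [X in _ + X]big1 ?addn0; last first.
  move=> j /andP[hj _]; apply/eqP; rewrite eqb0 -leqNgt.
  by move: hj; rewrite ltn_divLR // mulnC [j * n]mulnC [k * a]mulnC => /ltnW.
rewrite big_nat (eq_bigr (fun _ => 1)); last first.
  move=> j hj; apply/eqP; rewrite eqb1.
  have : n * j <= a * k by rewrite mulnC -leq_divRL //; lia.
  rewrite leq_eqVlt => /orP[/eqP e|//].
  have : n %| a * k by rewrite -e dvdn_mulr.
  rewrite Gauss_dvdr 1?coprime_sym // => /dvdn_leq; lia.
by rewrite -big_nat sum_nat_const_nat muln1 subn1.
Qed.

(** The two floor sums count the lattice points of a rectangle on either side of its diagonal, which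
    carries none because [m] and [n] are coprime. *)
Lemma sch_reciprocity m n : odd m -> odd n -> coprime m n ->
  sch m n (+) sch n m = odd m./2 && odd n./2.
Proof.
move=> om on cmn; have cnm : coprime n m by rewrite coprime_sym.
rewrite !sch_floor // -oddD -oddM; congr odd.
rewrite big_nat (eq_bigr (fun k => \sum_(1 <= j < m./2.+1) (n * j < m * k))); last first.
  by move=> k hk; apply: floor_count => //; lia.
rewrite -big_nat.
rewrite [X in _ + X]big_nat [X in _ + X](eq_bigr (fun k => \sum_(1 <= j < n./2.+1) (m * j < n * k))); last first.
  by move=> k hk; apply: floor_count => //; lia.
rewrite -big_nat exchange_big /= -big_split /=.
transitivity (\sum_(1 <= j < m./2.+1) \sum_(1 <= k < n./2.+1) 1).
  rewrite big_nat [RHS]big_nat; apply: eq_bigr => j hj.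
  rewrite -big_split /= big_nat [RHS]big_nat; apply: eq_bigr => k hk.
  have : n * j != m * k.
    apply/eqP => e; have : n %| m * k by rewrite -e dvdn_mulr.
    by rewrite Gauss_dvdr // => /dvdn_leq; lia.
  lia.
by rewrite sum_nat_const_nat sum_nat_const_nat; lia.
Qed.

(** * Euler's criterion modulo a prime *)

Lemma natr_Fp_eq0 p m : prime p -> (m%:R == 0 :> 'F_p)%R = (p %| m).
Proof. by move=> pp; rewrite (dvdn_pcharf (pchar_Fp pp)). Qed.

(** Gauss's lemma: the product of [a k] over the half system is, up to the flips, the product of the
    half system itself, which is invertible modulo [p]. *)
Lemma sch_euler p a : prime p -> odd p -> coprime a p ->
  (a%:R ^+ p./2 = (-1) ^+ sch a p :> 'F_p)%R.
Proof.
move=> pp op cap.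
have p0 := prime_gt0 pp.
pose h := p./2.
have H k : 0 < k <= h -> (a%:R * k%:R = (-1) ^+ flip p a k * (absres p a k)%:R :> 'F_p)%R.
  move=> hk; rewrite -natrM /flip /absres.
  have h1 := ltn_pmod (a * k) p0.
  have e : ((a * k)%:R = ((a * k) %% p)%:R :> 'F_p)%R.
    rewrite {1}(divn_eq (a * k) p) natrD natrM.
    have /eqP -> : (p%:R == 0 :> 'F_p)%R by rewrite natr_Fp_eq0.
    by rewrite mulr0 add0r.
  rewrite e; case: ifP => hr; last by rewrite expr0 mul1r.
  rewrite natrB 1?ltnW //.
  have /eqP -> : (p%:R == 0 :> 'F_p)%R by rewrite natr_Fp_eq0.
  by rewrite expr1 sub0r mulN1r opprK.
have E : (\prod_(1 <= k < h.+1) (a%:R * k%:R) = \prod_(1 <= k < h.+1) ((-1) ^+ flip p a k * (absres p a k)%:R) :> 'F_p)%R.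
  by rewrite big_nat [RHS]big_nat; apply: eq_bigr => k hk; apply: H; lia.
move: E; rewrite !big_split /= prodr_const_nat subn1 /=.
have -> : (\prod_(1 <= k < h.+1) (absres p a k)%:R = \prod_(1 <= k < h.+1) k%:R :> 'F_p)%R.
  by rewrite -[RHS](perm_big _ (absres_perm op cap)) big_map.
have nz : (\prod_(1 <= k < h.+1) k%:R != 0 :> 'F_p)%R.
  rewrite big_nat; elim/big_rec: _ => [|k x hk x0]; first exact: oner_neq0.
  rewrite mulf_neq0 // natr_Fp_eq0 //; apply/negP => /dvdn_leq; rewrite /h in hk; lia.
move/(mulIf nz) => ->.
rewrite /sch.
elim/big_rec2: _ => [//|k x y _ IH]; rewrite /= IH oddD oddb.
by case: flip; case: (odd _); rewrite /= ?expr0 ?expr1; ring.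
Qed.

(** The squares of [1, ..., h] are already [h] distinct roots of [X ^ h - 1]; if [a] were not among
    them, it would be one root too many. *)
Lemma sch_false_square p a : prime p -> odd p -> coprime a p -> ~~ sch a p ->
  exists x, a = x ^ 2 %[mod p].
Proof.
move=> pp op cap /negbTE sa.
have := sch_euler pp op cap; rewrite sa expr0 => ah.
set h := p./2 in ah.
have p2 := prime_gt1 pp.
have h0 : 0 < h by rewrite /h; lia.
pose rs : seq 'F_p := [seq (k%:R ^+ 2)%R | k <- index_iota 1 h.+1].
have [/mapP[k _ e]|nin] := boolP ((a%:R : 'F_p)%R \in rs).
  by exists k; move/(congr1 (fun z : 'F_p => nat_of_ord z)): e; rewrite -natrX !val_Fp_nat.
have p0 : ('X^h - 1 != 0 :> {poly 'F_p})%R.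
  by rewrite -size_poly_gt0 size_XnsubC.
have sz : size (a%:R%R :: rs) = h.+1 by rewrite /= size_map size_iota subn1.
have := max_poly_roots p0 _ _.
move/(_ (a%:R%R :: rs)); rewrite sz size_XnsubC // ltnn.
have pow k : 0 < k <= h -> (k%:R ^+ 2 ^+ h = 1 :> 'F_p)%R.
  move=> hk; rewrite -exprM.
  have kn : (k%:R != 0 :> 'F_p)%R by rewrite natr_Fp_eq0 //; apply/negP => /dvdn_leq; rewrite /h in hk; lia.
  apply: (mulfI kn); rewrite mulr1 -exprS.
  have -> : (2 * h).+1 = p by rewrite /h; lia.
  by rewrite -natrX -(Fp_nat_mod pp (k ^ p)) fermat_little // Fp_nat_mod.
move=> F; suff: false by []; apply: F.
- rewrite /= rootE !hornerE /= ah subrr eqxx /=.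
  apply/allP => x /mapP[k]; rewrite mem_index_iota => hk ->.
  rewrite rootE !hornerE pow ?subrr //; lia.
- rewrite /= nin map_inj_in_uniq ?iota_uniq // => k l.
  rewrite !mem_index_iota => hk hl /eqP; rewrite -subr_eq0 subr_sqr mulf_eq0.
  wlog kl : k l hk hl / k <= l.
    move=> W; case: (leqP k l) => [kl|/ltnW lk]; first exact: W.
    move=> e; apply/esym; apply: W => //; move: e.
    by rewrite -[(k%:R - l%:R)%R]opprB oppr_eq0 [(k%:R + l%:R)%R]addrC.
  rewrite -opprB oppr_eq0 -natrB // -natrD !natr_Fp_eq0 //.
  move=> /orP[] /dvdnP[[|c] hc]; try lia.
Qed.

(** * The quadratic character of [- n] *)

(** For a boolean [t], [t.+1] is [2 ^ t]. The factor 8 fixes the residues on which the symbols of -1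
    and 2 depend. *)
Definition modulus (t : bool) n := 8 * (t.+1 * n).

(** The terms are the symbol (e/n); then (-1/e) merged with the reciprocity sign, which survives
    only for [n] equal to 1 modulo 4; then (2/e), present when [t] holds. *)
Definition chi_sign (t : bool) n e : bool :=
  sch e n (+) (odd e./2 && ~~ odd n./2) (+) (t && odd (uphalf e./2)).

(* [chi t n] is the Kronecker symbol (-N/.) for [N = 2 ^ t * n], rewritten by reciprocity so that
   its multiplicativity and its period [8 N] are immediate. *)
Definition chi (t : bool) n e : rat :=
  if coprime e (modulus t n) then ((-1) ^+ chi_sign t n e)%R else 0%R.

Lemma coprime_modulus t n e : coprime e (modulus t n) = odd e && coprime e n.
Proof.
rewrite /modulus !coprimeMr (_ : 8 = 2 ^ 3) // coprime_pexpr // coprimen2.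
by case: t => /=; rewrite ?coprimen2 ?coprimen1; case: (odd e).
Qed.

Lemma odd_halfM a b : odd a -> odd b -> odd (a * b)./2 = odd a./2 (+) odd b./2.
Proof.
move=> oa ob; have ea : a = 2 * a./2 + 1 by lia.
have eb : b = 2 * b./2 + 1 by lia.
rewrite {1}ea {1}eb (_ : _ * _ = (2 * a./2 * b./2 + a./2 + b./2).*2.+1); last by lia.
by rewrite -uphalfE uphalf_double !oddD !oddM.
Qed.

(** The parity of [uphalf a./2] is the quadratic character of 2; it depends only on [a./2] modulo 4,
    which leaves sixteen cases. *)
Lemma odd_uphalf_halfM a b : odd a -> odd b ->
  odd (uphalf (a * b)./2) = odd (uphalf a./2) (+) odd (uphalf b./2).
Proof.
move=> oa ob; have ea : a = 2 * a./2 + 1 by lia.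
have eb : b = 2 * b./2 + 1 by lia.
rewrite {1}ea {1}eb (_ : _ * _ = (2 * a./2 * b./2 + a./2 + b./2).*2.+1); last by lia.
rewrite -uphalfE uphalf_double; move: a./2 b./2 => u v {ea eb oa ob}.
have eu := divn_eq u 4; have ev := divn_eq v 4.
have hu : u %% 4 < 4 by rewrite ltn_pmod.
have hv : v %% 4 < 4 by rewrite ltn_pmod.
move: (u %/ 4) (v %/ 4) (u %% 4) (v %% 4) eu ev hu hv => p q r s -> -> hr hs.
have [w ->] : exists w, 2 * (p * 4 + r) * (q * 4 + s) + (p * 4 + r) + (q * 4 + s) = 4 * w + (2 * r * s + r + s).
  by exists (8 * p * q + 2 * p * s + 2 * r * q + p + q); lia.
by case: r hr => [|[|[|[|//]]]] _; case: s hs => [|[|[|[|//]]]] _; lia.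
Qed.

Lemma chiM t n a b : odd n -> chi t n (a * b) = (chi t n a * chi t n b)%R.
Proof.
move=> on; rewrite /chi coprimeMl.
case: (boolP (coprime a _)) => [ha|]; last by rewrite mul0r.
case: (boolP (coprime b _)) => [hb|]; last by rewrite mulr0.
move: ha hb; rewrite !coprime_modulus => /andP[oa ca] /andP[ob cb].
rewrite -signr_addb /chi_sign schM // odd_halfM // odd_uphalf_halfM //; congr (_ ^+ _)%R.
by case: t; case: sch; case: sch; case: odd; case: odd; case: odd; case: odd; case: odd.
Qed.

Lemma chi_mod t n a : odd n -> chi t n (a %% modulus t n) = chi t n a.
Proof.
move=> on; rewrite /chi coprime_modl; case: ifP => // _; congr (_ ^+ _)%R; congr nat_of_bool.
have e := divn_eq a (modulus t n).
have es : sch (a %% modulus t n) n = sch a n.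
  rewrite -[LHS]sch_modl -[RHS]sch_modl; congr sch.
  by rewrite modn_dvdm // /modulus mulnA dvdn_mull.
move: e es; set r := a %% _; set q := a %/ _; rewrite /modulus => e es.
have {}e : a = 8 * (q * (t.+1 * n)) + r by rewrite {1}e; lia.
rewrite /chi_sign es; congr (_ (+) (_ && _) (+) (_ && _)); rewrite e; lia.
Qed.

(** The character is odd because [- N] is negative; the reflection [e -> P - e] will then cancel
    every full period. *)
Lemma chi_neg1 t n : odd n -> chi t n (modulus t n).-1 = (-1)%R.
Proof.
move=> on; have n0 : 0 < n by case: n on.
have M0 : 0 < modulus t n by rewrite /modulus !muln_gt0 n0.
rewrite /chi coprimePn //.
have -> : chi_sign t n (modulus t n).-1 = true; last by [].
rewrite /chi_sign.
have -> : sch (modulus t n).-1 n = odd n./2.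
  rewrite -sch_modl -sch_neg1 // -[RHS]sch_modl; congr sch.
  have -> : (modulus t n).-1 = (8 * t.+1).-1 * n + n.-1 by rewrite /modulus; case: (t); lia.
  by rewrite modnMDl.
have -> : odd (modulus t n).-1./2 = true by rewrite /modulus; case: (t); lia.
have -> : odd (uphalf (modulus t n).-1./2) = false by rewrite /modulus; case: (t); lia.
by rewrite andbF addbF; case: odd.
Qed.

(** Reciprocity is undone: [chi_sign] becomes the symbol of [- N] modulo [q], with [q.-1] in the
    role of -1. *)
Lemma chi_prime t n q : odd n -> prime q -> chi t n q = 1%R ->
  exists x, q %| x ^ 2 + t.+1 * n.
Proof.
move=> on pq; rewrite /chi coprime_modulus.
case: ifP => // /andP[oq cqn] /eqP.
have -> : ((-1) ^+ chi_sign t n q == 1 :> rat)%R = ~~ chi_sign t n q by case: chi_sign.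
have cnq : coprime n q by rewrite coprime_sym.
have q0 := prime_gt0 pq.
have c1 : coprime q.-1 q by rewrite coprime_sym coprimenP.
have c2 : coprime t.+1 q by case: (t); rewrite ?coprime2n ?coprime1n.
have st : sch t.+1 q = t && odd (uphalf q./2).
  case: (t) => /=; first by rewrite sch_2.
  by rewrite -(muln1 1) schM ?coprime1n // addbb.
move=> h.
have [] := @sch_false_square q (q.-1 * (t.+1 * n)) pq oq.
- by rewrite !coprimeMl c1 c2 cnq.
- rewrite !schM ?coprimeMl ?c2 // sch_neg1 // st.
  have := sch_reciprocity oq on cqn; move: h; rewrite /chi_sign.
  move: (t && _) (sch q n) (sch n q) (odd q./2) (odd n./2).
  by do 5 case.
- move=> x hx; exists x; apply/eqP.
  rewrite -modnDml -hx modnDml addnC -mulSn prednK //; apply/eqP.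
  by rewrite -/(dvdn _ _) dvdn_mulr.
Qed.

(** [2 N - 1] is an odd representative of -1 modulo [N]. It is 1 modulo 4 when [N] is odd and 3
    modulo 8 when [N] is even, and in both cases the signs cancel. *)
Lemma chi_class_12 t n : odd n -> (t || ~~ odd n./2) ->
  chi t n (2 * (t.+1 * n)).-1 = 1%R.
Proof.
move=> on ht; have n0 : 0 < n by case: n on ht.
rewrite /chi coprime_modulus.
have -> /= : odd (2 * (t.+1 * n)).-1 by lia.
have e : (2 * (t.+1 * n)).-1 = (2 * t.+1).-1 * n + n.-1 by case: (t); lia.
have -> : coprime (2 * (t.+1 * n)).-1 n.
  by rewrite e /coprime gcdnC gcdnMDl -/(coprime n n.-1) coprimenP.
have -> : chi_sign t n (2 * (t.+1 * n)).-1 = false; last by [].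
rewrite /chi_sign.
have -> : sch (2 * (t.+1 * n)).-1 n = odd n./2.
  by rewrite -sch_modl e modnMDl sch_modl sch_neg1.
case: t ht {e} => /= ht.
  have -> : odd (2 * (2 * n)).-1./2 = true by lia.
  have -> : odd (uphalf (2 * (2 * n)).-1./2) = true by lia.
  by case: odd.
rewrite (negbTE ht) addbF andbT (_ : odd _ = false) //; lia.
Qed.

(** Here -1 modulo [n] is a class of character -1. The class [n./2] satisfies [2 d = - 1] modulo
    [n], and the factor 2, also of symbol -1 when [n] is 3 modulo 8, corrects the sign. *)
Lemma chi_class_3 n : n %% 8 = 3 -> chi false n n./2 = 1%R.
Proof.
move=> hn; have on : odd n by lia.
have cp : coprime n./2 n.
  have {2}-> : n = 2 * n./2 + 1 by lia.
  by rewrite /coprime gcdnMDl gcdn1.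
rewrite /chi coprime_modulus cp andbT (_ : odd n./2); last by lia.
have -> : chi_sign false n n./2 = false; last by [].
rewrite /chi_sign addbF (_ : odd n./2); last by lia.
rewrite andbF addbF.
have := @schM 2 n./2 n on; rewrite coprime2n on => /(_ isT cp).
have -> : 2 * n./2 = n.-1 by lia.
rewrite sch_neg1 // sch_2 //.
have -> : odd n./2 by lia.
have -> : odd (uphalf n./2) by lia.
by case: sch.
Qed.

(** * Divisor sums of a character *)

Definition odd_character P (x : nat -> rat) :=
  [/\ forall a b, x (a * b) = (x a * x b)%R, forall a, x (a %% P) = x a,
      forall a, ~~ coprime a P -> x a = 0%R,
      forall a, coprime a P -> x a = 1%R \/ x a = (-1)%R & x P.-1 = (-1)%R].

Lemma chi_odd_character t n : odd n -> odd_character (modulus t n) (chi t n).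
Proof.
move=> on; split.
- by move=> a b; exact: chiM.
- by move=> a; exact: chi_mod.
- by move=> a /negbTE h; rewrite /chi h.
- by move=> a h; rewrite /chi h; case: chi_sign; [right|left].
- exact: chi_neg1.
Qed.

Definition divsum (x : nat -> rat) d : rat := (\sum_(1 <= e < d.+1 | (e %| d)%N) x e)%R.

Lemma divsum_widen x d N : 0 < d <= N ->
  divsum x d = (\sum_(1 <= e < N.+1 | (e %| d)%N) x e)%R.
Proof.
move=> hd; rewrite /divsum [RHS](@big_cat_nat _ _ _ d.+1) /=; [|lia|lia].
rewrite [X in (_ + X)%R]big_nat_cond [X in (_ + X)%R]big_pred0 ?addr0 //.
move=> e; apply/negP => /andP[he /dvdn_leq]; lia.
Qed.

Lemma big_multiples (F : nat -> rat) q N : 0 < q ->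
  (\sum_(1 <= e < N.+1 | (q %| e)%N) F e = \sum_(1 <= k < (N %/ q).+1) F (q * k)%N)%R.
Proof.
move=> q0; elim: N => [|N IH]; first by rewrite div0n !big_geq.
rewrite big_mkcond big_nat_recr //= -big_mkcond IH divnS //.
case: ifP => h; last by rewrite add0n addr0.
rewrite add1n [RHS]big_nat_recr //=; congr (_ + F _)%R.
have := divnK h; rewrite divnS // h; lia.
Qed.

Lemma weighted_divsum x (F : nat -> rat) X :
  (\sum_(1 <= d < X.+1) F d * divsum x d =
   \sum_(1 <= e < X.+1) x e * \sum_(1 <= m < (X %/ e).+1) F (e * m)%N)%R.
Proof.
transitivity (\sum_(1 <= d < X.+1) \sum_(1 <= e < X.+1 | (e %| d)%N) x e * F d)%R.
  rewrite big_nat [RHS]big_nat; apply: eq_bigr => d hd.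
  by rewrite (@divsum_widen _ _ X) // mulrC big_distrl.
rewrite (exchange_big_dep xpredT) //= big_nat [RHS]big_nat; apply: eq_bigr => e he.
rewrite -big_distrr /=; congr (_ * _)%R; apply: big_multiples; lia.
Qed.

Lemma divsum_pmul P x q k d : odd_character P x -> prime q -> coprime q d -> 0 < d ->
  (divsum x (q * (q ^ k * d))%N = x q * divsum x (q ^ k * d)%N + divsum x d)%R.
Proof.
move=> [xM _ _ _ _] pq cqd d0.
have q0 := prime_gt0 pq.
have D0 : 0 < q ^ k * d by rewrite muln_gt0 expn_gt0 q0.
rewrite [LHS](bigID (fun e => q %| e)) /=; congr (_ + _)%R.
  rewrite (eq_bigl (fun e => (q %| e) && (e %| q * (q ^ k * d)))); last by move=> e; rewrite andbC.
  rewrite big_mkcondr big_multiples // mulKn // /divsum big_distrr /= [RHS]big_mkcond /=.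
  apply: eq_bigr => e _; rewrite dvdn_pmul2l //; case: ifP => // _; exact: xM.
rewrite (@divsum_widen _ d (q * (q ^ k * d))); last first.
  by rewrite d0 mulnA -expnS leq_pmull // expn_gt0 q0.
apply: eq_bigl => e; rewrite mulnA -expnS.
apply/andP/idP => [[h1 h2]|h].
  by move: h1; rewrite Gauss_dvdr // coprime_sym coprimeXl // prime_coprime.
split; first exact: dvdn_mull.
by apply/negP => hq; move: cqd; rewrite prime_coprime // (dvdn_trans hq h).
Qed.

Lemma divsum_pfactor P x q k d : odd_character P x -> prime q -> coprime q d -> 0 < d ->
  (divsum x (q ^ k * d)%N = (\sum_(j < k.+1) x q ^+ j) * divsum x d)%R.
Proof.
move=> ox pq cqd d0; elim: k => [|k IH].
  by rewrite mul1n big_ord1 expr0 mul1r.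
rewrite expnS -mulnA (divsum_pmul _ ox) // IH [in RHS]big_ord_recl expr0 [RHS]mulrDl mul1r [LHS]addrC.
congr (_ + _)%R; rewrite mulrA; congr (_ * _)%R; rewrite big_distrr /=.
by apply: eq_bigr => i _; rewrite /bump /= exprS.
Qed.

Lemma geometric_unit (c : rat) k :
  [/\ (c = 0 -> \sum_(j < k.+1) c ^+ j = 1)%R,
      (c = 1 -> \sum_(j < k.+1) c ^+ j = k.+1%:R)%R &
      (c = -1 -> \sum_(j < k.+1) c ^+ j = (~~ odd k)%:R)%R].
Proof.
split=> ->.
- by rewrite big_ord_recl expr0 big1 ?addr0 // => i _; rewrite /bump /= exprS mul0r.
- rewrite (eq_bigr (fun _ => 1%R)) ?sumr_const ?card_ord // => i _; exact: expr1n.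
- elim: k => [|k IH]; first by rewrite big_ord1.
  rewrite big_ord_recr /= IH -signr_odd /=; case: (odd k); rewrite /= ?expr0 ?expr1; ring.
Qed.

Lemma pfactor_ind (Q : nat -> Prop) : Q 1 ->
  (forall q k d, prime q -> 0 < k -> coprime q d -> 0 < d -> Q d -> Q (q ^ k * d)) ->
  forall d, 0 < d -> Q d.
Proof.
move=> Q1 QS; elim/ltn_ind => d IH d0.
have [->//|d1] := eqVneq d 1.
have pq : prime (pdiv d) by apply: pdiv_prime; lia.
have [m cm em] := pfactor_coprime pq d0.
have l0 : 0 < logn (pdiv d) d by rewrite logn_gt0 mem_primes pq d0 pdiv_dvd.
have m0 : 0 < m by case: m em {cm} => //; lia.
rewrite em mulnC; apply: QS => //; apply: IH => //.
rewrite [in X in _ < X]em ltn_Pmulr // -(exp1n (logn (pdiv d) d)) ltn_exp2r //; exact: prime_gt1.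
Qed.

Lemma char_cases P x a : odd_character P x ->
  [\/ x a = 0%R, x a = 1%R | x a = (-1)%R].
Proof.
move=> [_ _ x0 x1 _]; case: (boolP (coprime a P)) => h.
  by case: (x1 a h) => ->; [constructor 2|constructor 3].
by constructor 1; exact: x0.
Qed.

Lemma divsum1 P x : 1 < P -> odd_character P x -> divsum x 1 = 1%R.
Proof.
move=> P1 [xM _ _ x1 _]; rewrite /divsum big_mkcond big_nat1 /=.
have := xM 1 1; case: (x1 1); rewrite ?coprime1n // => ->; lra.
Qed.

Lemma divsum_ge0 P x d : 1 < P -> odd_character P x -> 0 < d -> (0 <= divsum x d)%R.
Proof.
move=> P1 ox; move: d; apply: pfactor_ind => [|q k d pq k0 cqd d0 IH].
  by rewrite (divsum1 P1 ox).
rewrite (divsum_pfactor _ ox) // mulr_ge0 //.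
have [g0 g1 gN] := geometric_unit (x q) k.
by have [/g0|/g1|/gN] := char_cases q ox => ->; rewrite ?ler01 ?ler0n.
Qed.

Lemma divsum_square_ge1 P x m : 1 < P -> odd_character P x -> 0 < m ->
  (1 <= divsum x (m ^ 2)%N)%R.
Proof.
move=> P1 ox; move: m; apply: pfactor_ind => [|q k d pq k0 cqd d0 IH].
  by rewrite exp1n (divsum1 P1 ox).
rewrite expnMn -expnM (divsum_pfactor _ ox) ?coprimeXr ?expn_gt0 ?d0 //.
have [g0 g1 gN] := geometric_unit (x q) (k * 2).
suff : (1 <= \sum_(j < (k * 2).+1) x q ^+ j)%R by move=> h; nra.
have [/g0|/g1|/gN] := char_cases q ox => ->; rewrite ?ler1n //.
by rewrite oddM andbF.
Qed.

(** A prime [q] of odd exponent in [d] has [x q = 1], the value 0 being excluded by coprimality and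
    -1 by positivity. It joins [d1], and the roots [y] are glued by the Chinese remainder
    theorem. *)
Lemma divsum_decomposition P x n d : 1 < P -> odd_character P x ->
  (forall q, prime q -> x q = 1%R -> exists y, q %| y ^ 2 + n) ->
  0 < d -> coprime d P -> (0 < divsum x d)%R ->
  exists d1 m y, d = d1 * m ^ 2 /\ d1 %| y ^ 2 + n.
Proof.
move=> P1 ox xp; move: d; apply: pfactor_ind => [|q k d pq k0 cqd d0 IH].
  by exists 1, 1, 0.
rewrite coprimeMl => /andP[cq cd].
have {}cq : coprime q P by rewrite coprime_pexpl in cq.
rewrite (divsum_pfactor _ ox) // => h.
have fd := divsum_ge0 P1 ox d0.
have fd0 : (0 < divsum x d)%R.
  by rewrite lt_def fd andbT; apply/eqP => e; move: h; rewrite e mulr0.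
have [d1 [m [y [ed dy]]]] := IH cd fd0.
have [g0 g1 gN] := geometric_unit (x q) k.
have [_ _ _ x1 _] := ox.
have [k1|k1] := boolP (odd k); last first.
  exists d1, (m * q ^ k./2), y; split=> //.
  rewrite ed expnMn -expnM (_ : k./2 * 2 = k); last by lia.
  ring.
have [/(xp _ pq)[z qz]|/gN e] := x1 q cq; last by move: h; rewrite e k1 mul0r ltxx.
have cqd1 : coprime q d1.
  by move: cqd; rewrite ed coprimeMr => /andP[].
exists (q * d1), (m * q ^ k./2), (chinese q d1 z y); split.
  rewrite ed expnMn -expnM.
  have {1}-> : q ^ k = q * q ^ (k./2 * 2) by rewrite -expnS; congr (_ ^ _); lia.
  ring.
rewrite Gauss_dvd //; apply/andP; split.
  rewrite /dvdn -modnDml -modnXm chinese_modl // modnXm modnDml; exact: qz.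
rewrite /dvdn -modnDml -modnXm chinese_modr // modnXm modnDml; exact: dy.
Qed.

(** * Positivity of a divisor sum in a residue class *)

Lemma char_norm P x a : odd_character P x -> (`|x a| <= 1)%R.
Proof. by move=> ox; have [->|->|->] := char_cases a ox; rewrite ?normrN ?normr0 ?normr1. Qed.

Lemma char_reflect P x e : 0 < P -> odd_character P x -> e <= P -> (x (P - e)%N = - x e)%R.
Proof.
move=> P0 [xM xP _ _ xN] eP; rewrite -mulN1r -xN -xM -xP -[RHS]xP; congr x.
case: e eP => [|e] eP; first by rewrite subn0 muln0 modnn mod0n.
have -> : P.-1 * e.+1 = e * P + (P - e.+1) by nia.
by rewrite modnMDl.
Qed.

Lemma char_sum_le P x u v : odd_character P x -> u <= v ->
  (`|\sum_(u <= e < v) x e| <= (v - u)%:R)%R.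
Proof.
move=> ox uv; apply: le_trans (ler_norm_sum _ _ _) _.
apply: le_trans (_ : \sum_(u <= e < v) 1 <= _)%R.
  by apply: ler_sum => i _; exact: char_norm ox.
by rewrite sumr_const_nat.
Qed.

Lemma char_sum_period P x v : 1 < P -> odd_character P x ->
  (\sum_(0 <= e < v) x e = \sum_(0 <= e < v %% P) x e)%R.
Proof.
move=> P1 ox; have [_ xP x0 _ _] := ox.
have z0 : x 0 = 0%R by apply: x0; rewrite /coprime gcd0n; lia.
have full : (\sum_(0 <= e < P) x e = 0)%R.
  rewrite big_ltn ?(ltnW P1) // z0 add0r.
  have e : (\sum_(1 <= e < P) x e = - \sum_(1 <= e < P) x e)%R.
    rewrite {1}big_nat_rev /= -sumrN big_nat [RHS]big_nat; apply: eq_bigr => e he.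
    rewrite -(char_reflect _ ox); [congr x|..]; lia.
  lra.
have step w : (\sum_(0 <= e < P + w) x e = \sum_(0 <= e < w) x e)%R.
  rewrite (@big_cat_nat _ _ _ P) //= ?leq_addr // full add0r.
  rewrite -{1}[P]add0n big_addn addKn; apply: eq_bigr => e _.
  by rewrite -xP modnDr xP.
rewrite {1}(divn_eq v P); elim: (v %/ P) => [|k IH]; first by rewrite mul0n.
by rewrite mulSn -addnA step.
Qed.

Lemma char_sum_bound P x u v : 1 < P -> odd_character P x -> u <= v ->
  (`|\sum_(u <= e < v) x e| <= P%:R)%R.
Proof.
move=> P1 ox uv.
have -> : (\sum_(u <= e < v) x e = \sum_(0 <= e < v) x e - \sum_(0 <= e < u) x e)%R.
  by rewrite (@big_cat_nat _ _ _ u 0 v) //=; ring.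
rewrite (char_sum_period v P1 ox) (char_sum_period u P1 ox).
have hv : v %% P < P by rewrite ltn_pmod // ltnW.
have hu : u %% P < P by rewrite ltn_pmod // ltnW.
move: (v %% P) (u %% P) hv hu => {uv}v {}u.
wlog uv : u v / u <= v.
  move=> W hv hu; case: (leqP u v) => [uv|/ltnW uv]; first exact: W.
  by rewrite distrC; apply: W.
move=> hv hu.
have -> : (\sum_(0 <= e < v) x e - \sum_(0 <= e < u) x e = \sum_(u <= e < v) x e)%R.
  by rewrite (@big_cat_nat _ _ _ u 0 v) //=; ring.
apply: le_trans (char_sum_le ox uv) _; rewrite ler_nat; lia.
Qed.

(** Abel summation. The partial sum [s] accumulated so far is a parameter, so that the induction can
    peel off the first term. *)
Lemma abel_bound (c w : nat -> rat) (B s : rat) (u k : nat) :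
  (forall j : nat, (j <= k)%N -> `|s + \sum_(u <= i < u + j) c i| <= B)%R ->
  (forall i : nat, (u <= i <= u + k)%N -> 0 <= w i)%R ->
  (forall i : nat, (u <= i < u + k)%N -> w i.+1 <= w i)%R ->
  (`|s * w u + \sum_(u <= i < u + k) c i * w i| <= B * w u)%R.
Proof.
elim: k u s => [|k IH] u s hs w0 wd.
  rewrite addn0 big_geq // addr0 normrM (ger0_norm (w0 u _)); last lia.
  have := hs 0 isT; rewrite addn0 big_geq // addr0 => h.
  by apply: ler_wpM2r => //; apply: w0; lia.
have -> : u + k.+1 = u.+1 + k by lia.
rewrite big_ltn; last lia.
have h1 : (`|(s + c u) * w u.+1 + \sum_(u.+1 <= i < u.+1 + k) c i * w i| <= B * w u.+1)%R.
  apply: IH.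
  - move=> j hj; have := hs j.+1; rewrite ltnS => /(_ hj).
    rewrite big_ltn; last lia.
    by rewrite addrA (_ : u + j.+1 = u.+1 + j) //; lia.
  - by move=> i hi; apply: w0; lia.
  - by move=> i hi; apply: wd; lia.
have h2 : (`|s + c u| <= B)%R.
  by have := hs 1; rewrite addn1 big_nat1; apply.
have h3 : (w u.+1 <= w u)%R by apply: wd; lia.
move: (\sum_(_ <= _ < _) _)%R h1 => T h1.
have -> : (s * w u + (c u * w u + T) = (s + c u) * (w u - w u.+1) + ((s + c u) * w u.+1 + T))%R by ring.
apply: le_trans (ler_normD _ _) _.
rewrite normrM (ger0_norm (_ : 0 <= w u - w u.+1)%R); last by rewrite subr_ge0.
have : (`|s + c u| * (w u - w u.+1) <= B * (w u - w u.+1))%R.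
  by apply: ler_wpM2r => //; rewrite subr_ge0.
lra.
Qed.

Lemma char_abel P x (w : nat -> rat) (M : rat) (u v : nat) : 1 < P -> odd_character P x -> u <= v -> (0 <= M)%R ->
  ((u < v)%N -> w u <= M)%R ->
  (forall i : nat, (u <= i < v)%N -> 0 <= w i)%R ->
  (forall i : nat, (u <= i)%N -> (i.+1 < v)%N -> w i.+1 <= w i)%R ->
  (`|\sum_(u <= e < v) x e * w e| <= P%:R * M)%R.
Proof.
move=> P1 ox uv M0 wM w0 wd.
have [e|ne] := eqVneq u v.
  by rewrite -e big_geq // normr0 mulr_ge0.
(* Abel summation also evaluates the weight at the end point [v], where [w] is not controlled;
   extending by 0 keeps the weights decreasing. *)
pose w' i := if i < v then w i else 0%R.
have E : (\sum_(u <= e < v) x e * w e = \sum_(u <= e < u + (v - u)) x e * w' e)%R.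
  by rewrite subnKC // big_nat [RHS]big_nat; apply: eq_bigr => i /andP[_ hi]; rewrite /w' hi.
have := @abel_bound x w' P%:R 0 u (v - u).
rewrite E mul0r add0r => H.
have uv' : u < v by lia.
apply: le_trans (H _ _ _) _.
- by move=> j hj; rewrite add0r; apply: char_sum_bound => //; exact: leq_addr.
- by move=> i hi; rewrite /w'; case: ifP => // hv; apply: w0; lia.
- move=> i hi; rewrite /w'; case: ifP => hv; case: ifP => // hv'; try lia.
    by apply: wd; lia.
  by apply: w0; lia.
- by rewrite /w' uv' ler_wpM2l ?ler0n // wM.
Qed.

(** * Counting in residue classes and the hyperbola method *)

Lemma count_class P r v : 0 < r <= P ->
  \sum_(1 <= e < v.+1) (e == r %[mod P]) = (v + P - r) %/ P.
Proof.
move=> hr; have P0 : 0 < P by lia.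
elim: v => [|v IH]; first by rewrite big_geq // divn_small //; lia.
rewrite big_nat_recr //= IH.
have -> : v.+1 + P - r = (v + P - r).+1 by lia.
rewrite divnS // addnC; congr (nat_of_bool _ + _).
have -> : (v + P - r).+1 = v.+1 + P - r by lia.
rewrite -eqn_mod_dvd; last lia.
by rewrite modnDr.
Qed.

Lemma count_multiples_bound P m a v : 1 < P -> coprime m P ->
  (`|(\sum_(1 <= e < v.+1) (m * e == a %[mod P]) : nat)%:R - v%:R / P%:R| <= 1 :> rat)%R.
Proof.
move=> P1 cm; have P0 : 0 < P by lia.
have [r hr er] : exists2 r, 0 < r <= P & m * r = a %[mod P].
  (* The multiple of [m] congruent to [a], divided by [m]. The representative 0 is then replaced by
     [P], as [count_class] uses [1, ..., P]. *)
  pose r0 := (chinese m P 0 a) %/ m %% P.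
  have dm : m %| chinese m P 0 a.
    by rewrite /dvdn chinese_modl // mod0n.
  have er0 : m * r0 = a %[mod P].
    by rewrite /r0 modnMmr mulnC divnK // chinese_modr.
  have hr0 : r0 < P by rewrite ltn_pmod.
  case: (posnP r0) => [e0|p0]; last by exists r0; rewrite ?p0 //; lia.
  exists P; first by rewrite P0 leqnn.
  by rewrite -er0 e0 muln0 modnMl mod0n.
have -> : \sum_(1 <= e < v.+1) (m * e == a %[mod P]) = \sum_(1 <= e < v.+1) (e == r %[mod P]).
  apply: eq_bigr => e _; rewrite -er; congr nat_of_bool.
  wlog le : e r {hr er} / e <= r.
    move=> W; case: (leqP e r) => [h|/ltnW h]; first exact: W.
    by rewrite eq_sym W // eq_sym.
  rewrite eq_sym [RHS]eq_sym !eqn_mod_dvd ?leq_mul2l ?le ?orbT //.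
  by rewrite -mulnBr Gauss_dvdr // coprime_sym.
rewrite count_class //.
have h := divn_eq (v + P - r) P; have hm : (v + P - r) %% P < P by rewrite ltn_pmod.
move: ((v + P - r) %/ P) ((v + P - r) %% P) h hm => q s h hm.
have Pr : (0 < P%:R :> rat)%R by rewrite ltr0n.
have e1 : (v%:R + P%:R = q%:R * P%:R + s%:R + r%:R :> rat)%R.
  by rewrite -natrM -!natrD; congr _%:R%R; lia.
have s0 : (0 <= s%:R :> rat)%R by rewrite ler0n.
have sP : (s%:R <= P%:R :> rat)%R by rewrite ler_nat ltnW.
have [r0 rP] : (0 <= r%:R :> rat)%R /\ (r%:R <= P%:R :> rat)%R.
  by rewrite ler0n ler_nat; lia.
have -> : (q%:R - v%:R / P%:R = (P%:R - s%:R - r%:R) / P%:R :> rat)%R.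
  have -> : (v%:R = q%:R * P%:R + s%:R + r%:R - P%:R :> rat)%R by lra.
  by field; rewrite gt_eqF.
rewrite normrM normfV (gtr0_norm Pr) ler_pdivrMr // mul1r ler_norml; lra.
Qed.

Lemma big_nat_restrict (F : nat -> rat) (Q : pred nat) l k h : l <= k.+1 -> k <= h ->
  (forall m, l <= m <= h -> Q m = (m <= k)) ->
  (\sum_(l <= m < h.+1) (if Q m then F m else 0) = \sum_(l <= m < k.+1) F m)%R.
Proof.
move=> lk kh hQ; rewrite (@big_cat_nat _ _ _ k.+1) //=.
rewrite [X in (_ + X)%R]big_nat [X in (_ + X)%R]big1 ?addr0; last first.
  by move=> m hm; rewrite hQ; [rewrite (_ : m <= k = false) //|]; lia.
rewrite big_nat [RHS]big_nat; apply: eq_bigr => m hm; rewrite hQ; last lia.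
by rewrite (_ : m <= k) //; lia.
Qed.

(* Dirichlet's hyperbola switch: for [e > Y] the inner variable is at most [X / Y]. *)
Lemma hyperbola_tail (G : nat -> nat -> rat) X Y K : 0 < Y -> X = Y * K -> Y <= X ->
  (\sum_(Y.+1 <= e < X.+1) \sum_(1 <= m < (X %/ e)%N.+1) G e m =
   \sum_(1 <= m < K.+1) \sum_(Y.+1 <= e < (X %/ m)%N.+1) G e m)%R.
Proof.
move=> Y0 XE YX.
transitivity (\sum_(Y.+1 <= e < X.+1) \sum_(1 <= m < K.+1) if (e * m <= X)%N then G e m else 0)%R.
  rewrite big_nat [RHS]big_nat; apply: eq_bigr => e he; apply/esym.
  apply: big_nat_restrict => //.
    have : X %/ e <= X %/ Y by apply: leq_div2l; lia.
    by rewrite XE mulKn.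
  by move=> m hm; rewrite leq_divRL 1?mulnC //; lia.
rewrite exchange_big_nat /= big_nat [RHS]big_nat; apply: eq_bigr => m hm.
apply: big_nat_restrict.
- rewrite ltnS leq_divRL; last lia.
  by rewrite XE leq_mul2l; lia.
- exact: leq_div.
- by move=> e he; rewrite leq_divRL //; lia.
Qed.

Definition harmonic_char (x : nat -> rat) Y : rat := (\sum_(1 <= e < Y.+1) x e / e%:R)%R.

Lemma divn_rat_bound X e : 0 < e ->
  ((X%:R / e%:R - 1 <= (X %/ e)%:R :> rat) && ((X %/ e)%:R <= X%:R / e%:R :> rat))%R.
Proof.
move=> e0; have er : (0 < e%:R :> rat)%R by rewrite ltr0n.
have h := divn_eq X e; have hm : X %% e < e by rewrite ltn_pmod.
rewrite ler_pdivlMr // lerBlDr ler_pdivrMr // mulrDl mul1r.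
rewrite -!natrM -natrD !ler_nat; lia.
Qed.

(* Summing [divsum x d] over [d <= Y ^ 2] in the class of [a] by the hyperbola method gives
   [2 Y ^ 2 / P * harmonic_char x Y + O(Y)], because [x e = x m] when [e * m = a] and [x a = 1]. *)
Lemma harmonic_char_small P x a Y : 1 < P -> odd_character P x -> x a = 1%R ->
  0 < Y -> (forall d, 0 < d <= Y * Y -> d = a %[mod P] -> divsum x d = 0%R) ->
  (`|harmonic_char x Y| <= 3 * P%:R / Y%:R)%R.
Proof.
move=> P1 ox xa Y0 fz; have [xM xP x0 _ _] := ox.
pose X := Y * Y.
have YX : Y <= X by rewrite /X leq_pmull.
pose N e k : rat := (\sum_(1 <= m < k.+1) (e * m == a %[mod P])%:R)%R.
have T0 : (\sum_(1 <= e < X.+1) x e * N e (X %/ e)%N = 0)%R.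
  rewrite -(weighted_divsum x (fun d => (d == a %[mod P])%:R%R) X).
  rewrite big_nat big1 // => d hd; case: eqP => [h|]; last by rewrite mul0r.
  by rewrite fz ?mulr0 //; lia.
have T1 : (\sum_(Y.+1 <= e < X.+1) x e * N e (X %/ e)%N =
  \sum_(1 <= m < Y.+1) x m * (N m (X %/ m)%N - N m Y))%R.
  transitivity (\sum_(Y.+1 <= e < X.+1) \sum_(1 <= m < (X %/ e)%N.+1) x e * (e * m == a %[mod P])%:R)%R.
    by apply: eq_bigr => e _; rewrite /N big_distrr.
  rewrite (hyperbola_tail _ Y0 erefl YX) big_nat [RHS]big_nat; apply: eq_bigr => m hm.
  have -> : (N m (X %/ m)%N - N m Y = \sum_(Y.+1 <= e < (X %/ m)%N.+1) (m * e == a %[mod P])%:R)%R.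
    rewrite /N (@big_cat_nat _ _ _ Y.+1 1) //=; last first.
      by rewrite ltnS leq_divRL; [rewrite leq_mul2l|]; lia.
    ring.
  rewrite big_distrr /=; apply: eq_bigr => e _; rewrite [e * m]mulnC.
  case: eqP => [h|]; last by rewrite !mulr0.
  have : (x m * x e = 1)%R by rewrite -xM -xP h xP.
  have [->|->|->] := char_cases m ox; have [->|->|->] := char_cases e ox; lra.
have T2 : (\sum_(1 <= e < Y.+1) x e * (2 * N e (X %/ e)%N - N e Y) = 0)%R.
  rewrite -[RHS]T0 (@big_cat_nat _ _ _ Y.+1 1 X.+1) //= T1 -big_split /=.
  by apply: eq_bigr => e _; ring.
have Pr : (0 < P%:R :> rat)%R by rewrite ltr0n ltnW.
have Yr : (0 < Y%:R :> rat)%R by rewrite ltr0n.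
pose D e : rat := (x e * (2 * (X%:R / e%:R / P%:R) - Y%:R / P%:R))%R.
(* Each term errs by at most 4: the two counts contribute 2 and 1, and the rounding of [X / e] at
   most [2 / P <= 1]. *)
have T3 : (`|\sum_(1 <= e < Y.+1) D e| <= 4 * Y%:R)%R.
  rewrite -[X in `|X|%R]subr0 -[X in (_ - X)%R]T2 -sumrB.
  apply: le_trans (ler_norm_sum _ _ _) _.
  apply: le_trans (_ : \sum_(1 <= e < Y.+1) 4 <= _)%R; last first.
    by rewrite sumr_const_nat subn1 /= -[(4 *+ Y)%R]mulr_natr.
  rewrite big_nat [X in (_ <= X)%R]big_nat; apply: ler_sum => e he.
  rewrite /D -mulrBr normrM.
  have [ce|/x0 ->] := boolP (coprime e P); last by rewrite normr0 mul0r.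
  have C k : (`|N e k - k%:R / P%:R| <= 1)%R.
    have := count_multiples_bound a k P1 ce; rewrite natr_sum; exact.
  have /andP[d1 d2] := @divn_rat_bound X e ltac:(lia).
  have := C (X %/ e)%N; have := C Y; rewrite !ler_norml => /andP[c1 c2] /andP[c3 c4].
  have := char_norm e ox.
  set u := (X%:R / e%:R)%R in d1 d2 *.
  have f1 : ((X %/ e)%:R / P%:R <= u / P%:R)%R by rewrite ler_pM2r ?invr_gt0.
  have f2 : (u / P%:R - 1 / P%:R <= (X %/ e)%:R / P%:R)%R.
    by rewrite -mulrBl ler_pM2r ?invr_gt0.
  have f3 : (1 / P%:R <= 1 / 2 :> rat)%R.
    by rewrite !div1r lef_pV2 ?posrE // ler_nat.
  have : (`|2 * (u / P%:R) - Y%:R / P%:R - (2 * N e (X %/ e)%N - N e Y)| <= 4)%R.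
    by rewrite ler_norml; lra.
  move=> h1 h2; apply: le_trans (ler_wpM2r (normr_ge0 _) h2) _.
  by rewrite mul1r.
have T4 : (\sum_(1 <= e < Y.+1) D e =
    2 * X%:R / P%:R * harmonic_char x Y - Y%:R / P%:R * \sum_(1 <= e < Y.+1) x e)%R.
  rewrite /harmonic_char !big_distrr /= -sumrB big_nat [RHS]big_nat; apply: eq_bigr => e he.
  by rewrite /D; field; rewrite !pnatr_eq0; lia.
have T5 := @char_sum_bound P x 1 Y.+1 P1 ox isT.
have T6 : (`|Y%:R / P%:R * \sum_(1 <= e < Y.+1) x e| <= Y%:R)%R.
  rewrite normrM ger0_norm ?divr_ge0 ?ler0n //.
  apply: le_trans (ler_wpM2l _ T5) _; first by rewrite divr_ge0 ?ler0n.
  by rewrite divfK // gt_eqF.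
have T7 : (`|2 * X%:R / P%:R * harmonic_char x Y| <= 5 * Y%:R)%R.
  have -> : (2 * X%:R / P%:R * harmonic_char x Y = \sum_(1 <= e < Y.+1) D e + Y%:R / P%:R * \sum_(1 <= e < Y.+1) x e)%R.
    by rewrite T4; ring.
  apply: le_trans (ler_normD _ _) _; lra.
have e1 : (harmonic_char x Y = (P%:R / (2 * X%:R)) * (2 * X%:R / P%:R * harmonic_char x Y))%R.
  rewrite /X natrM; field; rewrite !gt_eqF //.
rewrite e1 normrM ger0_norm; last by rewrite divr_ge0 ?mulr_ge0 ?ler0n.
apply: le_trans (ler_wpM2l _ T7) _; first by rewrite divr_ge0 ?mulr_ge0 ?ler0n.
have -> : (P%:R / (2 * X%:R) * (5 * Y%:R) = 5 / 2 * (P%:R / Y%:R) :> rat)%R.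
  by rewrite /X natrM; field; rewrite gt_eqF.
have : (0 <= P%:R / Y%:R :> rat)%R by rewrite divr_ge0 ?ler0n.
lra.
Qed.

(** * The contribution of the squares *)

Lemma sum_le_squares (F : nat -> rat) Z :
  (forall d : nat, (0 < d <= Z ^ 2)%N -> 0 <= F d)%R ->
  (\sum_(1 <= k < Z.+1) F (k ^ 2)%N <= \sum_(1 <= d < (Z ^ 2).+1) F d)%R.
Proof.
elim: Z => [|Z IH] F0; first by rewrite !big_geq.
have ZZ : Z ^ 2 < Z.+1 ^ 2 by rewrite ltn_exp2r.
rewrite big_nat_recr //= [leRHS]big_nat_recr ?expn_gt0 //= lerD2r.
apply: le_trans (IH _) _; first by move=> d hd; apply: F0; lia.
rewrite (@big_cat_nat _ _ _ (Z ^ 2).+1 1 (Z.+1 ^ 2)) //= lerDl.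
rewrite big_nat; apply: sumr_ge0 => d hd; apply: F0; lia.
Qed.

Lemma sum_sub_squares (c : rat) Z :
  (\sum_(1 <= k < Z.+1) (c - (k ^ 2)%N%:R) = Z%:R * c - Z%:R * (Z%:R + 1) * (2 * Z%:R + 1) / 6)%R.
Proof.
elim: Z => [|Z IH]; first by rewrite big_geq // !mul0r subr0.
rewrite big_nat_recr //= IH natrX -natr1; by field.
Qed.

Lemma sum_linear (c : rat) e k :
  (\sum_(1 <= m < k.+1) (c - (e * m)%N%:R) = k%:R * c - e%:R * k%:R * (k%:R + 1) / 2)%R.
Proof.
elim: k => [|k IH]; first by rewrite big_geq // !mul0r !mulr0 !mul0r subr0.
rewrite big_nat_recr //= IH natrM -natr1; by field.
Qed.

(** With [r] the remainder of [X] modulo [e], the difference is exactly [r (e - r) / (2 e)]. Summed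
    against the character, the two main terms give [harmonic_char] and a plain character sum. *)
Lemma sum_linear_approx X e : 0 < e ->
  (`|\sum_(1 <= m < (X %/ e).+1) (X%:R - (e * m)%N%:R)
     - (X%:R * X%:R / 2 / e%:R - X%:R / 2)| <= e%:R :> rat)%R.
Proof.
move=> e0; rewrite sum_linear.
have er : (0 < e%:R :> rat)%R by rewrite ltr0n.
have h := divn_eq X e; have hm : X %% e < e by rewrite ltn_pmod.
have hX : (X%:R = (X %/ e)%:R * e%:R + (X %% e)%:R :> rat)%R by rewrite {1}h natrD natrM.
have r0 : (0 <= (X %% e)%:R :> rat)%R by rewrite ler0n.
have r1 : ((X %% e)%:R <= e%:R :> rat)%R by rewrite ler_nat ltnW.
rewrite hX; move: (X %/ e)%:R%R (X %% e)%:R%R e%:R%R er r0 r1 => k r f f0 r0 r1.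
have -> : (k * (k * f + r) - f * k * (k + 1) / 2 - ((k * f + r) * (k * f + r) / 2 / f - (k * f + r) / 2) = r * (f - r) / (2 * f) :> rat)%R.
  by field; rewrite gt_eqF.
rewrite ger0_norm ?divr_ge0 ?mulr_ge0 ?subr_ge0 //; try lra.
rewrite ler_pdivrMr; last lra.
have : (0 <= r * r)%R by rewrite mulr_ge0.
have : (r * f <= f * f)%R by rewrite ler_pM2r.
have : (0 <= f * f)%R by rewrite mulr_ge0 ?ltW.
lra.
Qed.

(** Here [Z = c k], [X = Z ^ 2] and [Y = c ^ 2 k]. After division by [Z ^ 2] it suffices that
    [5/2 p k + p/2 + c ^ 2 < c k / 2]. The choice [c = 6 p] makes the right side [3 p k], and
    [k = 100 p] makes the surplus [p k / 2 = 50 p ^ 2] exceed [p/2 + 36 p ^ 2]. *)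
Lemma hyperbola_estimate (R : realFieldType) (p c k : R) :
  (2 <= p -> c = 6 * p -> k = 100 * p ->
   (c * k) ^+ 2 * (c * k) ^+ 2 / 2 * (3 * p / (c ^+ 2 * k)) + (c * k) ^+ 2 / 2 * p
     + c ^+ 2 * k * (c ^+ 2 * k) + p * (c * k) ^+ 2 * k
   < c * k * (c * k) ^+ 2 - c * k * (c * k + 1) * (2 * (c * k) + 1) / 6)%R.
Proof.
move=> p2 ce ke.
have c0 : (4 <= c)%R by lra.
have k0 : (4 <= k)%R by lra.
have cn : c != 0%R by apply: lt0r_neq0; lra.
have kn : k != 0%R by apply: lt0r_neq0; lra.
have -> : ((c * k) ^+ 2 * (c * k) ^+ 2 / 2 * (3 * p / (c ^+ 2 * k)) = (c * k) ^+ 2 * (3 / 2 * p * k))%R.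
  by field; rewrite cn kn.
have z1 : (4 <= c * k)%R by nra.
have z2 : ((c * k) ^+ 2 * (c * k / 2) <= c * k * (c * k) ^+ 2 - c * k * (c * k + 1) * (2 * (c * k) + 1) / 6)%R.
  by move: (c * k)%R z1 => z z1; have : (z * 4 <= z * z)%R by [nra]; nra.
apply: lt_le_trans z2.
have -> : ((c * k) ^+ 2 * (3 / 2 * p * k) + (c * k) ^+ 2 / 2 * p + c ^+ 2 * k * (c ^+ 2 * k)
    + p * (c * k) ^+ 2 * k = (c * k) ^+ 2 * (5 / 2 * p * k + p / 2 + c ^+ 2))%R by field.
have q0 : (0 < (c * k) ^+ 2)%R by apply: exprn_gt0; lra.
rewrite ltr_pM2l // ce.
have : (p * (1 / 2 + 36 * p) < p * (k / 2))%R by rewrite ltr_pM2l; lra.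
lra.
Qed.

(* Otherwise [harmonic_char x Y = O(1 / Y)], so that the sum of [(Z ^ 2 - d) * divsum x d] over
   [d <= Z ^ 2] has no main term and is smaller than the contribution [Z ^ 3 / 2] of the squares [d]. *)
Lemma divsum_class P x a : 1 < P -> odd_character P x -> x a = 1%R ->
  exists2 d, 0 < d /\ d = a %[mod P] & (0 < divsum x d)%R.
Proof.
move=> P1 ox xa.
pose C := 6 * P; pose K := 100 * P; pose Z := C * K; pose X := Z ^ 2; pose Y := C * C * K.
have P0 : 0 < P by lia.
have C0 : 0 < C by rewrite /C; lia.
have K0 : 0 < K by rewrite /K; lia.
have Y0 : 0 < Y by rewrite /Y muln_gt0 K0 andbT muln_gt0 C0.
have XE : X = Y * K by rewrite /X /Y /Z expnMn; ring.
have YX : Y <= X by rewrite XE leq_pmulr.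
(* The search up to [Y * Y] is finite, hence decidable. If it fails, nonnegativity turns the failure
   into vanishing, as [harmonic_char_small] requires. *)
have [/existsP[d /and3P[d0 /eqP da fd]]|] :=
  boolP [exists d : 'I_(Y * Y).+1, [&& 0 < d, d == a %[mod P] & (0 < divsum x d)%R]].
  by exists d.
rewrite negb_exists => /forallP none; exfalso.
have fz d : 0 < d <= Y * Y -> d = a %[mod P] -> divsum x d = 0%R.
  move=> /andP[d0 dY] /eqP da; apply/eqP.
  rewrite eq_le (divsum_ge0 P1 ox d0) andbT leNgt.
  by have := none (Ordinal (dY : d < (Y * Y).+1)); rewrite /= d0 da.
have hS := harmonic_char_small P1 ox xa Y0 fz.
pose W e : rat := (\sum_(1 <= m < (X %/ e).+1) (X%:R - (e * m)%N%:R))%R.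
have total : (\sum_(1 <= d < X.+1) (X%:R - d%:R) * divsum x d = \sum_(1 <= e < X.+1) x e * W e)%R.
  exact: (weighted_divsum x (fun d => X%:R - d%:R)%R X).
have lower : (Z%:R * X%:R - Z%:R * (Z%:R + 1) * (2 * Z%:R + 1) / 6 <= \sum_(1 <= e < X.+1) x e * W e)%R.
  rewrite -total -sum_sub_squares.
  apply: le_trans (_ : \sum_(1 <= k < Z.+1) (X%:R - (k ^ 2)%:R) * divsum x (k ^ 2)%N <= _)%R; last first.
    apply: (@sum_le_squares (fun d => (X%:R - d%:R) * divsum x d)%R) => d hd.
    by rewrite mulr_ge0 ?subr_ge0 ?ler_nat ?(divsum_ge0 P1 ox) //; case/andP: hd.
  rewrite big_nat [leRHS]big_nat; apply: ler_sum => k hk.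
  rewrite ler_peMr ?(divsum_square_ge1 P1 ox) //; last by case/andP: hk.
  by rewrite subr_ge0 ler_nat leq_exp2r //; lia.
(* Beyond [Y] the order of summation is switched: for each of the [K] values of [m] the weights
   decrease in [e] from at most [X], so Abel summation costs [P X]. *)
have tail : (`|\sum_(Y.+1 <= e < X.+1) x e * W e| <= P%:R * X%:R * K%:R)%R.
  have -> : (\sum_(Y.+1 <= e < X.+1) x e * W e = \sum_(Y.+1 <= e < X.+1) \sum_(1 <= m < (X %/ e).+1) x e * (X%:R - (e * m)%N%:R))%R.
    by apply: eq_bigr => e _; rewrite /W big_distrr.
  rewrite (hyperbola_tail _ Y0 XE YX).
  apply: le_trans (ler_norm_sum _ _ _) _.
  apply: le_trans (_ : \sum_(1 <= m < K.+1) P%:R * X%:R <= _)%R; last first.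
    by rewrite sumr_const_nat subn1 /= -[(_ *+ K)%R]mulr_natr.
  rewrite big_nat [leRHS]big_nat; apply: ler_sum => m hm.
  apply: (@char_abel P x (fun e => X%:R - (e * m)%N%:R)%R) => //.
  - rewrite ltnS leq_divRL; [rewrite XE leq_mul2l|]; lia.
  - by move=> _; rewrite lerBlDr lerDl.
  - move=> e he; rewrite subr_ge0 ler_nat.
    by rewrite -leq_divRL; lia.
  - by move=> e _ _; rewrite lerD2l lerN2 ler_nat leq_mul2r leqnSn orbT.
have head : (`|\sum_(1 <= e < Y.+1) x e * W e| <= X%:R * X%:R / 2 * (3 * P%:R / Y%:R) + X%:R / 2 * P%:R + Y%:R * Y%:R)%R.
  have -> : (\sum_(1 <= e < Y.+1) x e * W e = X%:R * X%:R / 2 * harmonic_char x Y - X%:R / 2 * \sum_(1 <= e < Y.+1) x e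
     + \sum_(1 <= e < Y.+1) x e * (W e - (X%:R * X%:R / 2 / e%:R - X%:R / 2)))%R.
    rewrite /harmonic_char !big_distrr /= -sumrB -big_split /=.
    apply: eq_bigr => e _; ring.
  apply: le_trans (ler_normD _ _) _; apply: lerD.
    apply: le_trans (ler_normB _ _) _; apply: lerD.
      by rewrite normrM ger0_norm ?divr_ge0 ?mulr_ge0 ?ler0n // ler_wpM2l ?divr_ge0 ?mulr_ge0 ?ler0n.
    rewrite normrM ger0_norm ?divr_ge0 ?ler0n // ler_wpM2l ?divr_ge0 ?ler0n //.
    exact: (@char_sum_bound P x 1 Y.+1 P1 ox isT).
  apply: le_trans (ler_norm_sum _ _ _) _.
  apply: le_trans (_ : \sum_(1 <= m < Y.+1) Y%:R <= _)%R; last first.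
    by rewrite sumr_const_nat subn1 /= -[(_ *+ Y)%R]mulr_natr.
  rewrite big_nat [leRHS]big_nat; apply: ler_sum => e he.
  rewrite normrM.
  have h1 := char_norm e ox; have h2 := @sum_linear_approx X e ltac:(lia).
  apply: le_trans (ler_wpM2r (normr_ge0 _) h1) _; rewrite mul1r.
  by apply: le_trans h2 _; rewrite ler_nat; lia.
move: lower; rewrite (@big_cat_nat _ _ _ Y.+1 1 X.+1) //=.
move: tail head; rewrite !ler_norml => /andP[_ tail] /andP[_ head] lower.
have {tail head lower} := le_trans lower (lerD head tail); apply/negP; rewrite -ltNge.
have Pr : (2 <= P%:R :> rat)%R by rewrite ler_nat.
have -> : (Z%:R = C%:R * K%:R :> rat)%R by rewrite -natrM.
have -> : (X%:R = (C%:R * K%:R) ^+ 2 :> rat)%R by rewrite /X /Z natrX natrM.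
have -> : (Y%:R = C%:R ^+ 2 * K%:R :> rat)%R by rewrite /Y !natrM.
have Ce : (C%:R = 6 * P%:R :> rat)%R by rewrite natrM.
have Ke : (K%:R = 100 * P%:R :> rat)%R by rewrite natrM.
exact: hyperbola_estimate Pr Ce Ke.
Qed.

Lemma class_decomposition t n a : odd n -> chi t n a = 1%R ->
  exists d1 m y, d1 * m ^ 2 = a %[mod modulus t n] /\ coprime d1 (modulus t n) /\
    0 < d1 /\ d1 %| y ^ 2 + t.+1 * n.
Proof.
move=> on xa; have ox := chi_odd_character t on.
have P1 : 1 < modulus t n by rewrite /modulus; case: n on {xa ox} => // n _; lia.
have [d [d0 da] fd] := divsum_class P1 ox xa.
have cd : coprime d (modulus t n).
  rewrite -coprime_modl da coprime_modl; apply: contraT => ca.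
  by move: xa; rewrite /chi (negbTE ca).
have [d1 [m [y [ed dy]]]] := divsum_decomposition P1 ox (fun q pq => chi_prime on pq) d0 cd fd.
exists d1, m, y; rewrite -ed da; split=> //; split.
  by move: cd; rewrite ed coprimeMl => /andP[].
by split=> //; move: d0; rewrite ed muln_gt0 => /andP[].
Qed.

Lemma three_squares_datum n : n %% 4 = 1 \/ n %% 4 = 2 \/ n %% 8 = 3 ->
  exists D y w m b, 0 < D /\ y * y + n = D * w /\ n * b = D * (m * m) + 1.
Proof.
move=> hn; have n0 : 0 < n by lia.
have [hn12|hn3] : (n %% 4 = 1 \/ n %% 4 = 2) \/ n %% 8 = 3 by lia.
  have [t [k [ek ok hk]]] : exists t : bool, exists k, [/\ n = t.+1 * k, odd k & t || ~~ odd k./2].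
    case: (boolP (odd n)) => on; first by exists false, n; split; lia.
    by exists true, n./2; split; rewrite /=; lia.
  have [d1 [m [y [da [_ [d0 dy]]]]]] := class_decomposition ok (chi_class_12 ok hk).
  have dvd : n %| d1 * m ^ 2 + 1.
    have nP : n %| modulus t k by rewrite ek /modulus dvdn_mull.
    rewrite /dvdn -modnDml -(modn_dvdm (d1 * m ^ 2) nP) da (modn_dvdm _ nP) modnDml -ek.
    have -> : (2 * n).-1 + 1 = 2 * n by rewrite addn1 prednK // muln_gt0.
    by rewrite modnMl.
  exists d1, y, ((y ^ 2 + n) %/ d1), m, ((d1 * m ^ 2 + 1) %/ n).
  split=> //; split.
    by rewrite [RHS]mulnC divnK ?ek //; rewrite mulnn.
  by rewrite mulnC divnK // mulnn.
have on : odd n by lia.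
have eh : 2 * n./2 + 1 = n by lia.
have [d1 [m [y [da [cd [d0 dy]]]]]] := class_decomposition on (chi_class_3 hn3).
have od : odd d1 by move: cd; rewrite coprime_modulus => /andP[].
rewrite mul1n in dy.
(* Adding the odd [d1] changes the parity of [y]; for [z] odd, [z ^ 2 + n] is even, so that
   [D = 2 d1] divides it. *)
have [z oz dz] : exists2 z, odd z & d1 %| z ^ 2 + n.
  case: (boolP (odd y)) => oy; first by exists y.
  exists (y + d1); first by rewrite oddD od (negbTE oy).
  have -> : (y + d1) ^ 2 + n = (2 * y + d1) * d1 + (y ^ 2 + n) by rewrite -mulnn; lia.
  by rewrite dvdn_addr // dvdn_mull.
have d2 : 2 * d1 %| z ^ 2 + n.
  rewrite Gauss_dvd ?coprime2n // dz andbT dvdn2 oddD oddX oz on; by [].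
have dvd : n %| 2 * d1 * m ^ 2 + 1.
  have nP : n %| modulus false n by rewrite /modulus mul1n dvdn_mull.
  rewrite /dvdn -modnDml -mulnA -modnMmr -(modn_dvdm (d1 * m ^ 2) nP) da (modn_dvdm _ nP) modnMmr modnDml.
  by rewrite eh modnn.
exists (2 * d1), z, ((z ^ 2 + n) %/ (2 * d1)), m, ((2 * d1 * m ^ 2 + 1) %/ n).
split; first by rewrite muln_gt0.
split; first by rewrite [RHS]mulnC divnK // mulnn.
by rewrite mulnC divnK // mulnn.
Qed.

(** * The three squares theorem *)

Require Import Defs.
From Stdlib Require Import ZArith List Lia Permutation.
Import ListNotations.
Local Open Scope Z_scope.
Unset Implicit Arguments. Unset SsrRewrite.

Definition ternary a b c f g h x y z : Z :=
  a * x * x + b * y * y + c * z * z + 2 * f * y * z + 2 * g * x * z + 2 * h * x * y.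

Lemma nearest_multiple a h : 0 < a -> exists k, -a <= 2 * (h + k * a) <= a.
Proof.
intros a0. exists (- ((2 * h + a) / (2 * a))).
pose proof (Z.div_mod (2 * h + a) (2 * a)).
pose proof (Z.mod_pos_bound (2 * h + a) (2 * a)). nia.
Qed.

(* Gauss reduction: alternately shorten the leading coefficient [a] with [B = a b - h^2]
   fixed, and [B] with [a] fixed; when neither is possible [3 a^2 <= 4 B] and
   [3 B^2 <= 4 a], so that [a = B = 1]. *)
Lemma unimodular_ternary_three_squares (N : nat) : forall a b c f g h x y z,
  0 < a -> 0 < a * b - h * h ->
  a * b * c + 2 * f * g * h - a * f * f - b * g * g - c * h * h = 1 ->
  a + (a * b - h * h) <= Z.of_nat N ->
  exists u v w, ternary a b c f g h x y z = u * u + v * v + w * w.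
Proof.
induction N as [|N IH]; intros a b c f g h x y z a0 B0 det le; [lia|].
destruct (nearest_multiple a h a0) as [k hk].
assert (E1 : exists b' h' f' y', a * b' - h' * h' = a * b - h * h /\
   a * b' * c + 2 * f' * g * h' - a * f' * f' - b' * g * g - c * h' * h' = 1 /\ -a <= 2 * h' <= a /\
   exists x', ternary a b c f g h x y z = ternary a b' c f' g h' x' y' z).
{ exists (b + 2 * k * h + k * k * a), (h + k * a), (f + k * g), y.
  split; [ring|]. split; [rewrite <- det; ring|]. split; [lia|].
  exists (x - k * y). unfold ternary; ring. }
destruct E1 as (b' & h' & f' & y' & eB & det' & hh & x' & ->).
rewrite <- eB in *. clear b h f x y eB det k hk.
destruct (Z_lt_le_dec b' a) as [ba|ab].
{ destruct (IH b' a c g f' h' y' x' z) as (u & v & w & e).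
  - apply Z.mul_pos_cancel_l with a; [assumption|]. pose proof (Z.square_nonneg h'). lia.
  - rewrite (Z.mul_comm b' a). assumption.
  - rewrite <- det'; ring.
  - rewrite (Z.mul_comm b' a). lia.
  -
  exists u, v, w. rewrite <- e. unfold ternary; ring. }
set (B := a * b' - h' * h') in *.
destruct (nearest_multiple B (a * f' - g * h') B0) as [k hk].
assert (E2 : exists c' f'' g' y'', a * b' * c' + 2 * f'' * g' * h' - a * f'' * f'' - b' * g' * g' - c' * h' * h' = 1 /\
   -B <= 2 * (a * f'' - g' * h') <= B /\
   ternary a b' c f' g h' x' y' z = ternary a b' c' f'' g' h' x' y'' z).
{ exists (c + 2 * k * f' + k * k * b'), (f' + k * b'), (g + k * h'), (y' - k * z).
  split; [rewrite <- det'; ring|]. split.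
  - replace (a * (f' + k * b') - (g + k * h') * h') with (a * f' - g * h' + k * B) by (unfold B; ring). exact hk.
  - unfold ternary; ring. }
destruct E2 as (c' & f'' & g' & y'' & det'' & hH & ->).
clear hk k det' y' c f' g.
(* A 2 by 2 minor of the adjugate is an entry of the matrix times the determinant 1. So [B], [H] and
   [a c' - g'^2] form a binary form of determinant [a], and the second reduction mirrors the
   first. *)
assert (adj : B * (a * c' - g' * g') - (a * f'' - g' * h') * (a * f'' - g' * h') = a).
{ unfold B. rewrite <- (Z.mul_1_r a) at 5. rewrite <- det''. ring. }
destruct (Z_lt_le_dec (a * c' - g' * g') B) as [CB|BC].
{ destruct (IH a c' b' f'' h' g' x' z y'') as (u & v & w & e).
  - assumption.
  - apply Z.mul_pos_cancel_l with B; [assumption|].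
    pose proof (Z.square_nonneg (a * f'' - g' * h')). lia.
  - rewrite <- det''; ring.
  - lia.
  -
  exists u, v, w. rewrite <- e. unfold ternary; ring. }
set (H := a * f'' - g' * h') in *.
assert (i1 : 3 * (a * a) <= 4 * B) by (unfold B; nia).
assert (i2 : 3 * (B * B) <= 4 * a) by nia.
assert (a1 : a = 1) by nia.
assert (B1 : B = 1) by nia.
assert (h0 : h' = 0) by nia.
assert (H0 : H = 0) by nia.
subst a h'. unfold B, H in *.
assert (b1 : b' = 1) by lia. assert (f0 : f'' = 0) by lia.
subst b' f''. assert (c1 : c' = 1 + g' * g') by lia. subst c'.
exists (x' + g' * z), y'', z. unfold ternary; ring.
Qed.

(* The ternary form with matrix [[a, al, m], [al, D, 0], [m, 0, n]], where [al = y * b], has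
   determinant 1 and represents [n]. *)
Lemma three_squares_of_datum n D y w m b : 0 < n -> 0 < D ->
  y * y + n = D * w -> n * b = D * (m * m) + 1 ->
  exists u v t, n = u * u + v * v + t * t.
Proof.
intros n0 D0 e1 e2.
assert (b0 : 0 < b) by nia.
(* Modulo [D], [n b = 1] and [y^2 = - n], hence [(y b)^2 = - b]: this makes [al^2 + b] divisible by
   [D]. *)
set (al := y * b).
assert (e3 : exists a, a * D - al * al = b).
{ exists (b * b * w - b * m * m). unfold al.
  replace ((b * b * w - b * m * m) * D - y * b * (y * b)) with (b * b * (D * w - y * y) - b * (D * (m * m))) by ring.
  rewrite <- e1. replace (D * (m * m)) with (n * b - 1) by lia. ring. }
destruct e3 as [a e3].
destruct (unimodular_ternary_three_squares (Z.to_nat (a + b)) a D n 0 m al 0 0 1) as (u & v & t & e).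
- nia.
- lia.
- replace (a * D * n + 2 * 0 * m * al - a * 0 * 0 - D * m * m - n * al * al) with (n * (a * D - al * al) - D * (m * m)) by ring.
  rewrite e3. lia.
- rewrite e3, Z2Nat.id; nia.
- exists u, v, t. rewrite <- e. unfold ternary; ring.
Qed.

Lemma three_squares (n : Z) : 0 < n ->
  n mod 4 = 1 \/ n mod 4 = 2 \/ n mod 8 = 3 ->
  exists a b c, n = a * a + b * b + c * c.
Proof.
move=> n0 hn.
have [N eN] : exists N : nat, n = Z.of_nat N by exists (Z.to_nat n); lia.
have hN : (N %% 4 = 1 \/ N %% 4 = 2 \/ N %% 8 = 3)%nat.
  have := Z.div_mod n 4 ltac:(lia); have := Z.div_mod n 8 ltac:(lia).
  have := Z.mod_pos_bound n 4 ltac:(lia); have := Z.mod_pos_bound n 8 ltac:(lia).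
  by lia.
have [D [y [w [m [b [D0 [e1 e2]]]]]]] := three_squares_datum hN.
apply: (three_squares_of_datum n (Z.of_nat D) (Z.of_nat y) (Z.of_nat w) (Z.of_nat m) (Z.of_nat b)); lia.
Qed.

(** * Residues and polygonal numbers *)

(** An explicit quotient, in place of [mod], lets [lia] combine such conditions linearly. *)
Definition coprime3 (x : Z) := exists k, x = 3 * k + 1 \/ x = 3 * k - 1.

Ltac modlia := Z.div_mod_to_equations; lia.

Lemma square_mod3 x :
  (exists k j, x = 3 * k /\ x * x = 9 * j) \/ (coprime3 x /\ exists j, x * x = 3 * j + 1).
Proof.
assert (H : exists k, x = 3 * k \/ x = 3 * k + 1 \/ x = 3 * k - 1).
{ exists ((x + 1)/3). modlia. }
destruct H as [k [->|[->| ->]]].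
- left. exists k, (k * k). lia.
- right. split; [exists k; lia|]. exists (3 * k * k + 2 * k). lia.
- right. split; [exists k; lia|]. exists (3 * k * k - 2 * k). lia.
Qed.

Lemma square_mod8 x :
  (Z.Odd x /\ exists j, x * x = 8 * j + 1) \/
  (exists k j, x = 4 * k + 2 /\ x * x = 32 * j + 4) \/
  (exists k j, x = 4 * k /\ x * x = 16 * j).
Proof.
assert (T : forall k, exists j, k * k + k = 2 * j).
{ intros k. destruct (Z.Even_or_Odd k) as [[j ->]|[j ->]].
  - exists (2 * j * j + j). lia.
  - exists (2 * j * j + 3 * j + 1). lia. }
assert (H : exists k, x = 4 * k \/ x = 4 * k + 2 \/ x = 2 * k + 1).
{ destruct (Z.Even_or_Odd x) as [[j ->]|[j ->]]; [|exists j; lia].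
  destruct (Z.Even_or_Odd j) as [[i ->]|[i ->]]; exists i; lia. }
destruct H as [k [->|[->| ->]]].
- right; right. exists k, (k * k). lia.
- right; left. destruct (T k) as [j hj]. exists k, j. lia.
- left. split; [exists k; lia|]. destruct (T k) as [j hj]. exists j. lia.
Qed.

Lemma coprime3_sign a b : coprime3 a -> coprime3 b ->
  exists c, (c = b \/ c = -b) /\ coprime3 c /\ exists k, a = c + 3 * k.
Proof.
intros [i hi] [j hj].
assert (H : (exists k, a = b + 3 * k) \/ (exists k, a = -b + 3 * k)).
{ destruct hi, hj; [left; exists (i-j)|right; exists (i+j)|right; exists (i+j)|left; exists (i-j)]; lia. }
destruct H as [[k hk]|[k hk]].
- exists b. split; [lia|]. split; [exists j; lia|exists k; lia].
- exists (-b). split; [lia|]. split; [exists (-j); lia|exists k; lia].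
Qed.

Lemma odd_sign a b : Z.Odd a -> Z.Odd b ->
  exists c, (c = b \/ c = -b) /\ Z.Odd c /\ exists k, a = c + 4 * k.
Proof.
intros [i hi] [j hj].
assert (H : (exists k, a = b + 4 * k) \/ (exists k, a = -b + 4 * k)).
{ destruct (Z.Even_or_Odd (i-j)) as [[k hk]|[k hk]].
  - left; exists k; lia.
  - right; exists (k + j + 1); lia. }
destruct H as [[k hk]|[k hk]].
- exists b. split; [lia|]. split; [exists j; lia|exists k; lia].
- exists (-b). split; [lia|]. split; [exists (-j-1); lia|exists k; lia].
Qed.

(* If [3] divides [s] and [p], multiplying [(s + p sqrt -2)/3] by [1 + 2 sqrt -2] or by
   [1 - 2 sqrt -2], both of norm 9, removes a factor 3. *)
Lemma norm2_coprime3 (n : nat) : forall s p t, (Z.to_nat t < n)%nat ->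
  0 < t -> s * s + 2 * (p * p) = 3 * t ->
  exists s' p', coprime3 s' /\ coprime3 p' /\ s' * s' + 2 * (p' * p') = 3 * t.
Proof.
induction n as [|n IH]; intros s p t hn t0 e; [lia|].
destruct (square_mod3 s) as [(s1 & i & -> & hs)|(hs & i & hi)];
destruct (square_mod3 p) as [(p1 & j & -> & hp)|(hp & j & hj)]; try lia.
2:{ exists s, p. auto. }
clear hs hp i j.
assert (e1 : s1 * s1 + 2 * (p1 * p1) = t/3 /\ t = 3 * (t/3)) by modlia.
set (t1 := t/3) in *. destruct e1 as [e1 et].
(* Modulo 3, both coordinates of [(s2 + p2 sqrt -2) (1 + 2 sqrt -2)] are [s2 - p2] up to sign. If 3
   divides [t1], the recursion makes both coordinates coprime to 3 and a sign separates them;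
   otherwise exactly one of them is divisible by 3. *)
assert (H : exists s2 p2, s2 * s2 + 2 * (p2 * p2) = t1 /\ coprime3 (s2 - p2)).
{ assert (D : (exists u, t1 = 3 * u) \/ coprime3 t1).
  { destruct (square_mod3 t1) as [(k & _ & hk & _)|[h _]]; [left; exists k; lia|right; exact h]. }
  destruct D as [[u hu]|[u hu]].
  - destruct (IH s1 p1 u) as (s2 & p2 & h1 & h2 & h3); try lia.
    destruct (coprime3_sign s2 p2 h1 h2) as (p3 & hp & [v hv] & k & hk).
    exists s2, (-p3). split; [destruct hp; subst p3; lia|].
    destruct hv; [exists (2 * v + k + 1)|exists (2 * v + k - 1)]; lia.
  - exists s1, p1. split; [exact e1|].
    destruct (square_mod3 s1) as [(x & i & hx & hx2)|([x hx] & i & hi)];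
    destruct (square_mod3 p1) as [(y & j & hy & hy2)|([y hy] & j & hj)]; try lia.
    + exists (x - y). lia.
    + exists (x - y). lia. }
destruct H as (s2 & p2 & e2 & [k hk]).
exists (s2 - 4 * p2), (p2 + 2 * s2). split; [exists (k - p2); lia|].
split; [exists (s2 - k); lia|]. nia.
Qed.

(** Multiplication by [1 + sqrt -2], of norm 3, followed by the removal of common factors 3. *)
Lemma norm2_triple n u v : 0 < n -> u * u + 2 * (v * v) = n ->
  exists s p, coprime3 s /\ coprime3 p /\ s * s + 2 * (p * p) = 3 * n.
Proof.
intros n0 e.
apply (norm2_coprime3 (S (Z.to_nat n)) (u - 2 * v) (u + v)); lia.
Qed.

(** Division by an element of norm 3, possible once the sign of [p] is chosen so that it agrees with
    [s] modulo 3. *)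
Lemma norm2_third n s p : coprime3 s -> coprime3 p -> s * s + 2 * (p * p) = 3 * n ->
  exists u v, u * u + 2 * (v * v) = n.
Proof.
intros hs hp e. destruct (coprime3_sign s p hs hp) as (q & hq & _ & k & ->).
exists (q + k), k. destruct hq; subst q; lia.
Qed.

Lemma coprime3_sum_signs a b c : ~ (exists k, a * a + b * b + c * c = 3 * k) ->
  exists b' c', (b' = b \/ b' = -b) /\ (c' = c \/ c' = -c) /\ coprime3 (a + b' + c').
Proof.
intros h.
destruct (square_mod3 a) as [(x & i & hx & hx2)|(ha & i & hi)];
destruct (square_mod3 b) as [(y & j & hy & hy2)|(hb & j & hj)];
destruct (square_mod3 c) as [(z & l & hz & hz2)|(hc & l & hl)].
- destruct h. exists (3 * i + 3 * j + 3 * l). lia.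
- destruct hc as [z hz]. exists b, c. split; [lia|]. split; [lia|]. exists (x + y + z). lia.
- destruct hb as [y hy]. exists b, c. split; [lia|]. split; [lia|]. exists (x + y + z). lia.
- destruct (coprime3_sign b c hb hc) as (c' & hc' & [w hw] & k & hk).
  exists b, c'. split; [lia|]. split; [lia|]. destruct hw; [exists (x+2 * w+k+1)|exists (x+2 * w+k-1)]; lia.
- destruct ha as [x hx]. exists b, c. split; [lia|]. split; [lia|]. exists (x + y + z). lia.
- destruct (coprime3_sign a c ha hc) as (c' & hc' & [w hw] & k & hk).
  exists b, c'. split; [lia|]. split; [lia|]. destruct hw; [exists (y+2 * w+k+1)|exists (y+2 * w+k-1)]; lia.
- destruct (coprime3_sign a b ha hb) as (b' & hb' & [w hw] & k & hk).
  exists b', c. split; [lia|]. split; [lia|]. destruct hw; [exists (z+2 * w+k+1)|exists (z+2 * w+k-1)]; lia.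
- destruct h. exists (i + j + l + 1). lia.
Qed.

(* [3] times the reflection in the plane orthogonal to (1,1,1). *)
Lemma triple_reflection a b c :
  (a - 2 * b - 2 * c) * (a - 2 * b - 2 * c) + (b - 2 * a - 2 * c) * (b - 2 * a - 2 * c) + (c - 2 * a - 2 * b) * (c - 2 * a - 2 * b)
  = 9 * (a * a + b * b + c * c).
Proof. ring. Qed.

(** When 3 divides all coordinates, they are divided by 3 and reflected: each coordinate of three
    times the reflection is congruent to the sum of all three modulo 3, so only signs with sum
    coprime to 3 are needed. *)
Lemma squares3_coprime3 (n : nat) : forall a b c t, (Z.to_nat t < n)%nat ->
  0 < t -> a * a + b * b + c * c = 3 * t ->
  exists x y z, coprime3 x /\ coprime3 y /\ coprime3 z /\ x * x + y * y + z * z = 3 * t.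
Proof.
induction n as [|n IH]; intros a b c t hn t0 e; [lia|].
destruct (square_mod3 a) as [(a1 & i & -> & ha2)|(ha & i & hi)];
destruct (square_mod3 b) as [(b1 & j & -> & hb2)|(hb & j & hj)];
destruct (square_mod3 c) as [(c1 & l & -> & hc2)|(hc & l & hl)]; try lia.
2:{ exists a, b, c. auto. }
clear ha2 hb2 hc2 i j l.
assert (e1 : a1 * a1 + b1 * b1 + c1 * c1 = t/3 /\ t = 3 * (t/3)) by modlia.
set (t1 := t/3) in *. destruct e1 as [e1 et].
assert (H : exists x y z, x * x + y * y + z * z = t1 /\ coprime3 (x + y + z)).
{ destruct (square_mod3 t1) as [(k & _ & hk & _)|[[k hk] _]].
  - destruct (IH a1 b1 c1 k) as (x & y & z & hx & hy & hz & e2); try lia.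
    destruct (coprime3_sign x y hx hy) as (y' & hy' & _ & k1 & hk1).
    destruct (coprime3_sign x z hx hz) as (z' & hz' & _ & k2 & hk2).
    destruct hx as [w hw].
    exists x, y', (-z'). split; [destruct hy', hz'; subst y' z'; lia|].
    exists (w - k1 + k2). lia.
  - destruct (coprime3_sum_signs a1 b1 c1) as (y & z & hy & hz & h).
    { intros [u hu]. lia. }
    exists a1, y, z. split; [|exact h]. destruct hy, hz; subst y z; lia. }
destruct H as (x & y & z & e2 & [k hk]).
exists (x - 2 * y - 2 * z), (y - 2 * x - 2 * z), (z - 2 * x - 2 * y).
split; [exists (k - y - z); lia|]. split; [exists (k - x - z); lia|].
split; [exists (k - x - y); lia|]. rewrite triple_reflection. lia.
Qed.

Lemma three_squares_coprime3 k n : 0 < n -> n = 3 * k -> n mod 4 = 1 \/ n mod 4 = 2 ->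
  exists a b c, coprime3 a /\ coprime3 b /\ coprime3 c /\ a * a + b * b + c * c = n.
Proof.
intros n0 -> h. destruct (three_squares (3 * k)) as (a & b & c & e); [lia|tauto|].
apply (squares3_coprime3 (S (Z.to_nat k)) a b c); lia.
Qed.

(** [P] carries a property of all three coordinates, such as [coprime3], through the permutation
    that puts the odd one first. *)
Lemma squares3_mod4_1 (P : Z -> Prop) a b c n : P a -> P b -> P c ->
  a * a + b * b + c * c = 4 * n + 1 ->
  exists x y z, P x /\ P (2 * y) /\ P (2 * z) /\ Z.Odd x /\ x * x + 4 * (y * y) + 4 * (z * z) = 4 * n + 1.
Proof.
intros pa pb pc e.
assert (D : forall x, Z.Odd x \/ exists y, x = 2 * y).
{ intros x. destruct (Z.Even_or_Odd x) as [[y hy]|h]; [right; exists y; lia|tauto]. }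
destruct (D a) as [[a1 ha]|[a1 ha]]; destruct (D b) as [[b1 hb]|[b1 hb]];
destruct (D c) as [[c1 hc]|[c1 hc]]; subst; try (exfalso; lia).
- exists (2 * a1 + 1), b1, c1. repeat split; auto; [exists a1|]; lia.
- exists (2 * b1 + 1), a1, c1. repeat split; auto; [exists b1|]; lia.
- exists (2 * c1 + 1), a1, b1. repeat split; auto; [exists c1|]; lia.
Qed.

Lemma squares3_mod4_2 (P : Z -> Prop) a b c n : P a -> P b -> P c ->
  a * a + b * b + c * c = 4 * n + 2 ->
  exists x y z, P x /\ P y /\ P (2 * z) /\ Z.Odd x /\ Z.Odd y /\ x * x + y * y + 4 * (z * z) = 4 * n + 2.
Proof.
intros pa pb pc e.
assert (D : forall x, Z.Odd x \/ exists y, x = 2 * y).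
{ intros x. destruct (Z.Even_or_Odd x) as [[y hy]|h]; [right; exists y; lia|tauto]. }
destruct (D a) as [[a1 ha]|[a1 ha]]; destruct (D b) as [[b1 hb]|[b1 hb]];
destruct (D c) as [[c1 hc]|[c1 hc]]; subst; try (exfalso; lia).
- exists (2 * a1 + 1), (2 * b1+1), c1. repeat split; auto; [exists a1|exists b1|]; lia.
- exists (2 * a1 + 1), (2 * c1+1), b1. repeat split; auto; [exists a1|exists c1|]; lia.
- exists (2 * b1 + 1), (2 * c1+1), a1. repeat split; auto; [exists b1|exists c1|]; lia.
Qed.

Lemma squares3_mod8_3 a b c n : a * a + b * b + c * c = 8 * n + 3 ->
  Z.Odd a /\ Z.Odd b /\ Z.Odd c.
Proof.
intros e.
destruct (square_mod8 a) as [[ha [i hi]]|[(i & i' & ha & hi)|(i & i' & ha & hi)]];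
destruct (square_mod8 b) as [[hb [j hj]]|[(j & j' & hb & hj)|(j & j' & hb & hj)]];
destruct (square_mod8 c) as [[hc [l hl]]|[(l & l' & hc & hl)|(l & l' & hc & hl)]];
try (exfalso; lia); auto.
Qed.

(** * Polygonal numbers as squares in residue classes *)

Lemma pgon_3 x : 8 * pgon 3 x + 1 = (2 * x + 1) * (2 * x + 1).
Proof.
unfold pgon. replace ((3-2) * x * x - (3-4) * x) with (x * x + x) by ring.
assert (exists k, x * x + x = 2 * k) as [k hk].
{ destruct (Z.Even_or_Odd x) as [[j ->]|[j ->]]; [exists (2 * j * j+j)|exists (2 * j * j+3 * j+1)]; lia. }
rewrite hk, (Z.mul_comm 2 k), Z.div_mul; lia.
Qed.

Lemma pgon_4 x : pgon 4 x = x * x.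
Proof.
unfold pgon. replace ((4-2) * x * x - (4-4) * x) with (x * x * 2) by ring. apply Z.div_mul. lia.
Qed.

Lemma pgon_5 x : 24 * pgon 5 x + 1 = (6 * x - 1) * (6 * x - 1).
Proof.
unfold pgon. replace ((5-2) * x * x - (5-4) * x) with (3 * (x * x) - x) by ring.
assert (exists k, 3 * (x * x) - x = 2 * k) as [k hk].
{ destruct (Z.Even_or_Odd x) as [[j ->]|[j ->]]; [exists (6 * j * j-j)|exists (6 * j * j+5 * j+1)]; lia. }
rewrite hk, (Z.mul_comm 2 k), Z.div_mul; lia.
Qed.

Lemma pgon_8 x : 3 * pgon 8 x + 1 = (3 * x - 1) * (3 * x - 1).
Proof.
unfold pgon. replace ((8-2) * x * x - (8-4) * x) with ((3 * (x * x) - 2 * x) * 2) by ring.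
rewrite Z.div_mul; lia.
Qed.

Lemma square_pgon_8 X T : X * X = 3 * T + 1 -> exists x, pgon 8 x = T.
Proof.
intros e. destruct (square_mod3 X) as [(k & j & _ & h)|[[k [h|h]] _]]; [lia| |].
- exists (-k). pose proof (pgon_8 (-k)). subst X. lia.
- exists k. pose proof (pgon_8 k). subst X. lia.
Qed.

Lemma square_pgon_5 X T : X * X = 24 * T + 1 -> exists x, pgon 5 x = T.
Proof.
intros e. destruct (Z.Even_or_Odd X) as [[j h]|[j h]]; [subst X; lia|].
destruct (square_mod3 X) as [(k & i & _ & h')|[[k [h'|h']] _]]; [lia| |].
- destruct (Z.Even_or_Odd k) as [[l hl]|[l hl]]; [|lia].
  exists (-l). pose proof (pgon_5 (-l)). subst k X. lia.
- destruct (Z.Even_or_Odd k) as [[l hl]|[l hl]]; [|lia].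
  exists l. pose proof (pgon_5 l). subst k X. lia.
Qed.

Lemma coprime6_pgon_5 X : Z.Odd X -> coprime3 X -> exists x, 24 * pgon 5 x + 1 = X * X.
Proof.
intros ho hc. destruct (square_mod8 X) as [[_ [i hi]]|[(k & j & h & _)|(k & j & h & _)]].
2,3: destruct ho; lia.
destruct (square_mod3 X) as [(k & j & h & _)|[_ [j hj]]]; [destruct hc; lia|].
destruct (square_pgon_5 X ((X * X - 1)/24)) as [x hx]; [modlia|].
exists x. rewrite hx. modlia.
Qed.

Lemma coprime3_pgon_8 X : coprime3 X -> exists x, 3 * pgon 8 x + 1 = X * X.
Proof.
intros hc. destruct (square_mod3 X) as [(k & j & h & _)|[_ [j hj]]]; [destruct hc; lia|].
destruct (square_pgon_8 X j) as [x hx]; [lia|]. exists x. lia.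
Qed.

Lemma odd_pgon_3 X : Z.Odd X -> exists x, 8 * pgon 3 x + 1 = X * X.
Proof. intros [x ->]. exists x. apply pgon_3. Qed.

Lemma pgon_5_square x : exists X, Z.Odd X /\ coprime3 X /\ 24 * pgon 5 x + 1 = X * X.
Proof.
exists (6 * x - 1). split; [exists (3 * x - 1); lia|]. split; [exists (2 * x); lia|apply pgon_5].
Qed.

Lemma pgon_8_square x : exists X, coprime3 X /\ 3 * pgon 8 x + 1 = X * X.
Proof. exists (3 * x - 1). split; [exists x; lia|apply pgon_8]. Qed.

Lemma pgon_3_square x : exists X, Z.Odd X /\ 8 * pgon 3 x + 1 = X * X.
Proof. exists (2 * x + 1). split; [exists x; lia|apply pgon_3]. Qed.

Lemma pgon_nonneg m x : 3 <= m -> 0 <= pgon m x.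
Proof.
intros hm. unfold pgon. apply Z.div_pos; [|lia].
replace ((m-2) * x * x - (m-4) * x) with ((m-3) * (x * x - x) + (x * x + x)) by ring.
assert (0 <= x * x - x) by nia. assert (0 <= x * x + x) by nia. nia.
Qed.

(** * Sums of polygonal numbers and rewriting of subsums *)

Definition form := list (Z * Z).

Fixpoint rep (F : form) (N : Z) : Prop :=
  match F with
  | [] => N = 0
  | (c, r) :: F' => exists x, rep F' (N - c * pgon r x)
  end.

Definition complete (F : form) := forall N, 0 <= N -> rep F N.

Definition scale k (F : form) : form := map (fun t => (k * fst t, snd t)) F.

Lemma rep_permutation F G : Permutation F G -> forall N, rep F N -> rep G N.
Proof.
induction 1 as [|[c r] F G _ IH|[c r] [d s] F|F G H _ IH1 _ IH2]; intros N; cbn.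
- auto.
- intros [x h]. exists x. auto.
- intros (x & y & h). exists y, x. replace (N - c * pgon r y - d * pgon s x) with (N - d * pgon s x - c * pgon r y) by lia. exact h.
- auto.
Qed.

Lemma rep_app F G N : rep (F ++ G) N <-> exists M, rep F M /\ rep G (N - M).
Proof.
revert N. induction F as [|[c r] F IH]; intros N; cbn.
- split.
  + intros h. exists 0. rewrite Z.sub_0_r. auto.
  + intros (M & -> & h). rewrite Z.sub_0_r in h. exact h.
- split.
  + intros [x h]. apply IH in h. destruct h as (M & h1 & h2).
    exists (c * pgon r x + M). split.
    * exists x. replace (c * pgon r x + M - c * pgon r x) with M by lia. exact h1.
    * replace (N - (c * pgon r x + M)) with (N - c * pgon r x - M) by lia. exact h2.
  + intros (M & [x h1] & h2). exists x. apply IH. exists (M - c * pgon r x).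
    split; [exact h1|]. replace (N - c * pgon r x - (M - c * pgon r x)) with (N - M) by lia. exact h2.
Qed.

Lemma rep_scale k F N : rep (scale k F) N <-> exists M, rep F M /\ N = k * M.
Proof.
revert N. induction F as [|[c r] F IH]; intros N; cbn.
- split; [intros ->; exists 0; lia|intros (M & -> & ->); lia].
- split.
  + intros [x h]. apply IH in h. destruct h as (M & h1 & h2).
    exists (M + c * pgon r x). split; [exists x|lia].
    replace (M + c * pgon r x - c * pgon r x) with M by lia. exact h1.
  + intros (M & [x h1] & ->). exists x. apply IH. exists (M - c * pgon r x). split; [exact h1|lia].
Qed.

Fixpoint remove_term (t : Z * Z) (F : form) : option form :=
  match F with
  | [] => None
  | u :: F' => if andb (fst t =? fst u) (snd t =? snd u) then Some F'
               else option_map (cons u) (remove_term t F')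
  end.

Fixpoint remove_terms (L F : form) : option form :=
  match L with
  | [] => Some F
  | t :: L' => match remove_term t F with Some F' => remove_terms L' F' | None => None end
  end.

Lemma remove_term_permutation t F F' : remove_term t F = Some F' -> Permutation F (t :: F').
Proof.
revert F'. induction F as [|u F IH]; intros F'; cbn; [discriminate|].
destruct (andb (fst t =? fst u) (snd t =? snd u)) eqn:e.
- intros [= <-]. apply andb_prop in e. destruct e as [e1 e2].
  apply Z.eqb_eq in e1, e2. destruct t, u; cbn in *; subst. auto.
- destruct (remove_term t F) as [G|]; [|discriminate]. cbn. intros [= <-].
  rewrite (IH G erefl). apply perm_swap.
Qed.

Lemma remove_terms_permutation L F G : remove_terms L F = Some G -> Permutation F (L ++ G).
Proof.
revert F. induction L as [|t L IH]; intros F; cbn.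
- intros [= ->]. auto.
- destruct (remove_term t F) as [F'|] eqn:e; [|discriminate]. intros h.
  rewrite (remove_term_permutation _ _ _ e). auto.
Qed.

Definition rule := (form * form)%type.
Definition sound (r : rule) := forall N, rep (fst r) N -> rep (snd r) N.

(* [G] arises from [F] by replacing a subsum [k * fst r] with [k * snd r]. *)
Definition rewrites (F G : form) (kr : Z * rule) : bool :=
  match remove_terms (scale (fst kr) (fst (snd kr))) F, remove_terms (scale (fst kr) (snd (snd kr))) G with
  | Some F', Some G' => match remove_terms F' G' with Some [] => true | _ => false end
  | _, _ => false
  end.

Lemma rewrites_complete F G k r : sound r -> rewrites F G (k, r) = true -> complete F -> complete G.
Proof.
unfold rewrites; cbn. intros hr.
destruct (remove_terms (scale k (fst r)) F) as [F'|] eqn:eF; [|discriminate].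
destruct (remove_terms (scale k (snd r)) G) as [G'|] eqn:eG; [|discriminate].
destruct (remove_terms F' G') as [[|? ?]|] eqn:eG'; try discriminate. intros _ hF N N0.
apply remove_terms_permutation in eF, eG, eG'. rewrite app_nil_r in eG'.
apply (rep_permutation (scale k (snd r) ++ F')).
{ rewrite eG, eG'. reflexivity. }
pose proof (rep_permutation _ _ eF _ (hF N N0)) as h.
apply rep_app in h. destruct h as (M & h1 & h2). apply rep_app. exists M. split; [|exact h2].
apply rep_scale in h1. apply rep_scale. destruct h1 as (K & h1 & ->). exists K. auto.
Qed.

Definition extends (F G : form) : bool :=
  match remove_terms F G with Some _ => true | None => false end.

Lemma pgon_0 r : pgon r 0 = 0.
Proof. unfold pgon. rewrite !Z.mul_0_r. reflexivity. Qed.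

Lemma rep_0 F : rep F 0.
Proof.
induction F as [|[c r] F IH]; cbn; [reflexivity|]. exists 0. rewrite pgon_0, Z.mul_0_r. exact IH.
Qed.

Lemma extends_complete F G : extends F G = true -> complete F -> complete G.
Proof.
unfold extends. destruct (remove_terms F G) as [H|] eqn:e; [|discriminate]. intros _ hF N N0.
apply remove_terms_permutation in e. apply (rep_permutation (F ++ H)); [symmetry; exact e|].
apply rep_app. exists N. rewrite Z.sub_diag. split; [auto|apply rep_0].
Qed.

(** The values 0 and 1 of the new term settle the parity of [N]. *)
Lemma complete_double F r : pgon r 1 = 1 -> complete F -> complete ((1, r) :: scale 2 F).
Proof.
intros hr hF N N0. cbn [rep].
destruct (Z.Even_or_Odd N) as [[M ->]|[M ->]].
- exists 0. rewrite pgon_0. apply rep_scale. exists M. split; [apply hF|]; lia.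
- exists 1. rewrite hr. apply rep_scale. exists M. split; [apply hF|]; lia.
Qed.

Definition kr_list (rules : list rule) : list (Z * rule) := list_prod [1; 2; 3; 4; 6] rules.

Definition step (rules : list rule) (known todo : list form) : list form * list form :=
  let '(new, rest) := partition (fun G => existsb (fun F => existsb (rewrites F G) (kr_list rules)) known) todo in
  (new ++ known, rest).

(** The fuel bounds the number of breadth-first rounds. Too little fuel, or too few multipliers in
    [kr_list], can only make the answer [false]. *)
Fixpoint saturates (n : nat) (rules : list rule) (known todo : list form) : bool :=
  match n with
  | O => match todo with [] => true | _ => false end
  | S n' => let '(known', todo') := step rules known todo in saturates n' rules known' todo'
  end.

Lemma saturates_complete n rules : Forall sound rules -> forall known todo,
  saturates n rules known todo = true -> Forall complete known -> Forall complete todo.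
Proof.
intros hr. induction n as [|n IH]; intros known todo; cbn.
- destruct todo; [auto|discriminate].
- unfold step.
  destruct (partition (fun G => existsb (fun F => existsb (rewrites F G) (kr_list rules)) known) todo)
    as [new rest] eqn:e.
  intros h hk.
  assert (hn : Forall complete new).
  { apply Forall_forall. intros G hG.
    assert (hG' : existsb (fun F => existsb (rewrites F G) (kr_list rules)) known = true).
    { pose proof (partition_as_filter (fun G => existsb (fun F => existsb (rewrites F G) (kr_list rules)) known) todo) as p.
      rewrite e in p. injection p as -> _. apply filter_In in hG. apply hG. }
    apply existsb_exists in hG'. destruct hG' as (F & hF & hG').
    apply existsb_exists in hG'. destruct hG' as ([k r] & hkr & hG').
    apply in_prod_iff in hkr. rewrite Forall_forall in hk, hr.
    apply (rewrites_complete F G k r); [apply hr, hkr|exact hG'|apply hk, hF]. }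
  assert (hk' : Forall complete (new ++ known)) by (apply Forall_app; auto).
  specialize (IH _ _ h hk'). rewrite Forall_forall in *. intros G hG.
  destruct (proj1 (elements_in_partition _ _ e G) hG); auto.
Qed.

Lemma rep2 a r b s N : rep [(a, r); (b, s)] N <-> exists x y, a * pgon r x + b * pgon s y = N.
Proof. cbn. split; intros (x & y & e); exists x, y; lia. Qed.

Lemma rep3 a r b s c t N : rep [(a, r); (b, s); (c, t)] N <->
  exists x y z, a * pgon r x + b * pgon s y + c * pgon t z = N.
Proof. cbn. split; intros (x & y & z & e); exists x, y, z; lia. Qed.

Lemma rep4 a r b s c t d u N : rep [(a, r); (b, s); (c, t); (d, u)] N <->
  exists x y z w, a * pgon r x + b * pgon s y + c * pgon t z + d * pgon u w = N.
Proof. cbn. split; intros (x & y & z & w & e); exists x, y, z, w; lia. Qed.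

(** * Replacements of two terms *)

Lemma norm2_pos_even s p k : s * s + 2 * (p * p) = 8 * k + 1 -> Z.Odd s /\ exists q, p = 2 * q.
Proof.
intros e. destruct (Z.Even_or_Odd s) as [[i hi]|hs]; [subst s; exfalso; lia|]. split; [exact hs|].
destruct (Z.Even_or_Odd p) as [[i hi]|[i hi]]; [exists i; lia|].
destruct (square_mod8 s) as [[_ [j hj]]|[(j & j' & h & _)|(j & j' & h & _)]]; subst; exfalso; lia.
Qed.

Lemma norm2_odd_odd s p k : s * s + 2 * (p * p) = 8 * k + 3 -> Z.Odd s /\ Z.Odd p.
Proof.
intros e. destruct (Z.Even_or_Odd s) as [[i hi]|hs]; [subst s; exfalso; lia|]. split; [exact hs|].
destruct (Z.Even_or_Odd p) as [[i hi]|hp]; [|exact hp].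
destruct (square_mod8 s) as [[_ [j hj]]|[(j & j' & h & _)|(j & j' & h & _)]]; destruct hs; subst; exfalso; lia.
Qed.

(** In a name each term is its coefficient, if not 1, followed by its index. Completing squares,
    [p_3], [p_4], [p_5] and [p_8] ask for odd numbers, arbitrary ones, those prime to 6 and those
    prime to 3. The first three rules exchange [s^2 + 2 p^2 = 3 n] and [u^2 + 2 v^2 = n];
    [rule_33_5] and [rule_3_3] live in [Z[i]], [rule_3_5] in [Z[(1 + sqrt -3)/2]]. *)
Definition rule_5_8 : rule := ([(1, 5); (1, 8)], [(1, 3); (2, 3)]).
Definition rule_45_8 : rule := ([(4, 5); (1, 8)], [(4, 3); (1, 4)]).
Definition rule_5_25 : rule := ([(1, 5); (2, 5)], [(1, 3); (1, 4)]).
Definition rule_33_5 : rule := ([(3, 3); (1, 5)], [(2, 5); (1, 8)]).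
Definition rule_3_5 : rule := ([(1, 3); (1, 5)], [(1, 5); (3, 5)]).
Definition rule_3_3 : rule := ([(1, 3); (1, 3)], [(2, 3); (1, 4)]).
Definition opposite (r : rule) : rule := (snd r, fst r).

Ltac start_rule :=
  intros N; cbn [fst snd opposite]; unfold rule_5_8, rule_45_8, rule_5_25, rule_33_5, rule_3_5, rule_3_3;
  cbn [fst snd]; rewrite !rep2; intros (x & y & e).

Lemma sound_5_8 : sound rule_5_8.
Proof.
start_rule.
destruct (pgon_5_square x) as (X & hX & hX3 & eX). destruct (pgon_8_square y) as (Y & hY3 & eY).
assert (h2Y : coprime3 (2 * Y)) by (destruct hY3 as [k [?|?]]; [exists (2 * k + 1)|exists (2 * k - 1)]; lia).
destruct (norm2_third (8 * N + 3) X (2 * Y) hX3 h2Y) as (u & v & h); [lia|].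
destruct (norm2_odd_odd _ _ _ h) as [hu hv].
destruct (odd_pgon_3 u hu) as [a ha]. destruct (odd_pgon_3 v hv) as [b hb].
exists a, b. lia.
Qed.

Lemma sound_5_8_opposite : sound (opposite rule_5_8).
Proof.
start_rule.
destruct (pgon_3_square x) as (X & hX & eX). destruct (pgon_3_square y) as (Y & hY & eY).
pose proof (pgon_nonneg 3 x ltac:(lia)). pose proof (pgon_nonneg 3 y ltac:(lia)).
destruct (norm2_triple (8 * N + 3) X Y) as (s & p & hs & hp & h); [lia|lia|].
destruct (norm2_pos_even s p (3 * N + 1)) as [hs2 [q ->]]; [lia|].
assert (hq : coprime3 q) by (destruct hp as [k [?|?]]; exists (q - k); lia).
destruct (coprime6_pgon_5 s hs2 hs) as [a ha]. destruct (coprime3_pgon_8 q hq) as [b hb].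
exists a, b. lia.
Qed.

Lemma sound_45_8 : sound rule_45_8.
Proof.
start_rule.
destruct (pgon_5_square x) as (X & hX & hX3 & eX). destruct (pgon_8_square y) as (Y & hY3 & eY).
destruct (norm2_third (2 * N + 1) X Y hX3 hY3) as (u & v & h); [lia|].
destruct (Z.Even_or_Odd u) as [[i hi]|hu]; [subst u; exfalso; lia|].
destruct (odd_pgon_3 u hu) as [a ha].
exists a, v. rewrite pgon_4. lia.
Qed.

Lemma sound_45_8_opposite : sound (opposite rule_45_8).
Proof.
start_rule.
destruct (pgon_3_square x) as (X & hX & eX). rewrite pgon_4 in e.
pose proof (pgon_nonneg 3 x ltac:(lia)). pose proof (Z.square_nonneg y).
destruct (norm2_triple (2 * N + 1) X y) as (s & p & hs & hp & h); [lia|lia|].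
destruct (Z.Even_or_Odd s) as [[i hi]|hs2]; [subst s; exfalso; lia|].
destruct (coprime6_pgon_5 s hs2 hs) as [a ha]. destruct (coprime3_pgon_8 p hp) as [b hb].
exists a, b. lia.
Qed.

Lemma sound_5_25 : sound rule_5_25.
Proof.
start_rule.
destruct (pgon_5_square x) as (X & hX & hX3 & eX). destruct (pgon_5_square y) as (Y & hY & hY3 & eY).
destruct (norm2_third (8 * N + 1) X Y hX3 hY3) as (u & v & h); [lia|].
destruct (norm2_pos_even _ _ _ h) as [hu [q ->]].
destruct (odd_pgon_3 u hu) as [a ha].
exists a, q. rewrite pgon_4. lia.
Qed.

Lemma sound_5_25_opposite : sound (opposite rule_5_25).
Proof.
start_rule.
destruct (pgon_3_square x) as (X & hX & eX). rewrite pgon_4 in e.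
pose proof (pgon_nonneg 3 x ltac:(lia)). pose proof (Z.square_nonneg y).
destruct (norm2_triple (8 * N + 1) X (2 * y)) as (s & p & hs & hp & h); [lia|lia|].
destruct (norm2_odd_odd s p (3 * N)) as [hs2 hp2]; [lia|].
destruct (coprime6_pgon_5 s hs2 hs) as [a ha]. destruct (coprime6_pgon_5 p hp2 hp) as [b hb].
exists a, b. lia.
Qed.

Lemma sound_33_5 : sound rule_33_5.
Proof.
start_rule.
destruct (pgon_3_square x) as (X & [i hi] & eX). destruct (pgon_5_square y) as (Y & [j hj] & hY3 & eY).
(* [U] and [V] are [(3 X + Y)/2] and [(3 X - Y)/2], the division of [3 X + i Y] by [1 - i]; exactly
   one of them is even. *)
set (U := 3 * i + j + 2). set (V := 3 * i - j + 1).
assert (hU3 : coprime3 U) by (unfold U; destruct hY3 as [k [?|?]]; exists (i + j - k + 1); lia).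
assert (hV3 : coprime3 V) by (unfold V; destruct hY3 as [k [?|?]]; exists (i - j + k); lia).
assert (h : U * U + V * V = 12 * N + 5) by (unfold U, V; subst X Y; lia).
assert (H : exists A B, Z.Odd A /\ coprime3 A /\ coprime3 B /\ A * A + 4 * (B * B) = 12 * N + 5).
{ destruct (Z.Even_or_Odd U) as [[k hk]|hU]; destruct (Z.Even_or_Odd V) as [[l hl]|hV];
  [exfalso; unfold U, V in *; lia| | |exfalso; destruct hU, hV; unfold U, V in *; lia].
  - exists V, k. repeat split; auto; [|lia]. destruct hU3 as [m hm]. exists (k - m). lia.
  - exists U, l. repeat split; auto; [|lia]. destruct hV3 as [m hm]. exists (l - m). lia. }
destruct H as (A & B & hA & hA3 & hB3 & hAB).
destruct (coprime6_pgon_5 A hA hA3) as [a ha]. destruct (coprime3_pgon_8 B hB3) as [b hb].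
exists a, b. lia.
Qed.

(** The inverse transformation: the new roots are [(X + 2 Z)/3] and [X - 2 Z], the sign of [Z] being
    chosen to make the first integral. *)
Lemma sound_33_5_opposite : sound (opposite rule_33_5).
Proof.
start_rule.
destruct (pgon_5_square x) as (X & hX & hX3 & eX). destruct (pgon_8_square y) as (Y & hY3 & eY).
destruct (coprime3_sign X Y hX3 hY3) as (Z & hZ & hZ3 & k & hk).
destruct hX as [i hi].
destruct (odd_pgon_3 (Z + k)) as [a ha]; [exists (i - k); lia|].
destruct (coprime6_pgon_5 (3 * k - Z)) as [b hb].
{ exists (i - Z). lia. }
{ destruct hZ3 as [j hj]. exists (k - j). lia. }
exists a, b. assert (h : X * X + 4 * (Z * Z) = 12 * N + 5) by (destruct hZ; subst Z; lia).
subst X. lia.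
Qed.

Lemma sound_3_5 : sound rule_3_5.
Proof.
start_rule.
destruct (pgon_3_square x) as (X & hX & eX). destruct (pgon_5_square y) as (Y & hY & hY3 & eY).
assert (H : exists A B, Z.Odd A /\ coprime3 A /\ Z.Odd B /\ coprime3 B /\ A * A + 3 * (B * B) = 24 * N + 4).
{ destruct (square_mod3 X) as [(k & _ & hk & _)|[hX3 _]]; [|exists Y, X; repeat split; auto; lia].
  destruct (odd_sign Y X hY hX) as (Z & hZ & [j hj] & l & hl).
  assert (hz : exists z, Z = 3 * z) by (destruct hZ; [exists k|exists (-k)]; lia).
  destruct hz as [z hz]. destruct hY3 as [m hm].
  (* [A = (Y - 3 Z)/2] and [B = (Y + Z)/2]: multiplication by a unit of [Z[(1 + sqrt -3)/2]]. *)
  exists (2 * l - Z), (Z + 2 * l).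
  split; [exists (l - j - 1); lia|].
  split; [destruct hm; [exists (2 * (m - z - l) - z + 1)|exists (2 * (m - z - l) - z - 1)]; lia|].
  split; [exists (l + j); lia|].
  split; [destruct hm; [exists (2 * (m - z - l) + z + 1)|exists (2 * (m - z - l) + z - 1)]; lia|].
  replace (24 * N + 4) with (Y * Y + 3 * (Z * Z)) by (destruct hZ; subst Z; lia). subst Y. ring. }
destruct H as (A & B & hA & hA3 & hB & hB3 & hAB).
destruct (coprime6_pgon_5 A hA hA3) as [a ha]. destruct (coprime6_pgon_5 B hB hB3) as [b hb].
exists a, b. lia.
Qed.

(** Three times a generalized pentagonal number is triangular, with the same square root. *)
Lemma sound_3_5_opposite : sound (opposite rule_3_5).
Proof.
start_rule.
destruct (pgon_5_square y) as (Y & hY & _ & eY). destruct (odd_pgon_3 Y hY) as [a ha].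
exists a, x. lia.
Qed.

Lemma sound_3_3 : sound rule_3_3.
Proof.
start_rule.
destruct (pgon_3_square x) as (X & hX & eX). destruct (pgon_3_square y) as (Y & hY & eY).
destruct (odd_sign X Y hX hY) as (Z & hZ & [j hj] & k & hk).
destruct (odd_pgon_3 (Z + 2 * k)) as [a ha]; [exists (j + k); lia|].
exists a, k. rewrite pgon_4. destruct hZ; subst; lia.
Qed.

Lemma sound_3_3_opposite : sound (opposite rule_3_3).
Proof.
start_rule.
destruct (pgon_3_square x) as (X & [i hi] & eX). rewrite pgon_4 in e.
destruct (odd_pgon_3 (X + 2 * y)) as [a ha]; [exists (i + y); lia|].
destruct (odd_pgon_3 (X - 2 * y)) as [b hb]; [exists (i - y); lia|].
exists a, b. lia.
Qed.

(** * Universal sums *)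

Lemma complete_25_8_8 : complete [(2, 5); (1, 8); (1, 8)].
Proof.
intros N N0. apply rep3.
destruct (three_squares_coprime3 (4 * N + 3) (12 * N + 9)) as (a & b & c & ha & hb & hc & e);
  [lia|lia|left; modlia|].
destruct (squares3_mod4_1 coprime3 a b c (3 * N + 2)) as (X & y & z & hX & hy & hz & oX & e'); auto; [lia|].
destruct (coprime6_pgon_5 X oX hX) as [u hu].
destruct (coprime3_pgon_8 y) as [v hv]; [destruct hy as [k hk]; exists (y - k); lia|].
destruct (coprime3_pgon_8 z) as [w hw]; [destruct hz as [k hk]; exists (z - k); lia|].
exists u, v, w. lia.
Qed.

Lemma odd_square x : Z.Odd x -> exists k, x * x = 8 * k + 1.
Proof.
intros [i hi]. destruct (square_mod8 x) as [[_ h]|[(k & j & h & _)|(k & j & h & _)]]; [exact h| |]; exfalso; lia.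
Qed.

Lemma squares3_mod3_2 a b c n : a * a + b * b + c * c = 3 * n + 2 ->
  (exists k, a = 3 * k /\ coprime3 b /\ coprime3 c) \/
  (exists k, b = 3 * k /\ coprime3 a /\ coprime3 c) \/
  (exists k, c = 3 * k /\ coprime3 a /\ coprime3 b).
Proof.
intros e.
destruct (square_mod3 a) as [(x & i & hx & hx2)|(ha & i & hi)];
destruct (square_mod3 b) as [(y & j & hy & hy2)|(hb & j & hj)];
destruct (square_mod3 c) as [(z & l & hz & hz2)|(hc & l & hl)]; try (exfalso; lia).
- left. exists x. auto.
- right; left. exists y. auto.
- right; right. exists z. auto.
Qed.

(* [X = a], [Y = (b + c)/2], [Z = (b - c)/4] with [b] the coordinate divisible by 3. *)
Lemma complete_5_25_8 : complete [(1, 5); (2, 5); (1, 8)].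
Proof.
intros N N0. apply rep3.
destruct (three_squares (24 * N + 11)) as (a & b & c & e); [lia|right; right; modlia|].
destruct (squares3_mod8_3 a b c (3 * N + 1)) as (oa & ob & oc); [lia|].
assert (H : exists x y z, Z.Odd x /\ Z.Odd y /\ Z.Odd z /\ coprime3 x /\ coprime3 z /\
  (exists k, y = 3 * k) /\ x * x + y * y + z * z = 24 * N + 11).
{ destruct (squares3_mod3_2 a b c (8 * N + 3)) as [(k & h & h1 & h2)|[(k & h & h1 & h2)|(k & h & h1 & h2)]]; [lia| | |].
  - exists b, a, c. repeat split; auto; try lia; exists k; lia.
  - exists a, b, c. repeat split; auto; try lia; exists k; lia.
  - exists a, c, b. repeat split; auto; try lia; exists k; lia. }
destruct H as (x & y & z & ox & oy & oz & hx & hz & [k hk] & h).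
destruct (odd_sign y z oy oz) as (z' & hz' & [j hj] & l & hl).
assert (hz3 : coprime3 z') by (destruct hz' as [->| ->]; [exact hz|destruct hz as [i hi]; exists (-i); lia]).
destruct hz3 as [i hi].
destruct (coprime6_pgon_5 x ox hx) as [u hu].
destruct (coprime6_pgon_5 (z' + 2 * l)) as [v hv].
{ exists (j + l). lia. }
{ destruct hi; [exists (k - 2 * (k - i - l) + 1)|exists (k - 2 * (k - i - l) - 1)]; lia. }
destruct (coprime3_pgon_8 l) as [w hw].
{ exists (k - i - l). lia. }
exists u, v, w. assert (z * z = z' * z') by (destruct hz'; subst; lia). subst y. lia.
Qed.

(* [X = (a + b)/2], [Y = c], [Z = (a - b)/4] *)
Lemma complete_3_23_43 : complete [(1, 3); (2, 3); (4, 3)].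
Proof.
intros N N0. apply rep3.
destruct (three_squares (16 * N + 14)) as (a & b & c & e); [lia|right; left; modlia|].
destruct (squares3_mod4_2 (fun _ => True) a b c (4 * N + 3)) as (x & y & z & _ & _ & _ & ox & oy & h); auto; [lia|].
destruct (odd_sign x y ox oy) as (y' & hy & [j hj] & k & hk).
assert (h' : (y' + 2 * k) * (y' + 2 * k) + 2 * (z * z) + 4 * (k * k) = 8 * N + 7) by (destruct hy; subst; lia).
destruct (odd_pgon_3 (y' + 2 * k)) as [u hu]; [exists (j + k); lia|].
assert (oz : Z.Odd z /\ Z.Odd k).
{ destruct (square_mod8 z) as [[oz [i hi]]|[(i & i' & hz & hi)|(i & i' & hz & hi)]];
  destruct (square_mod8 k) as [[ok [l hl]]|[(l & l' & hz' & hl)|(l & l' & hz' & hl)]]; auto; exfalso; lia. }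
destruct oz as [oz ok].
destruct (odd_pgon_3 z oz) as [v hv]. destruct (odd_pgon_3 k ok) as [w hw].
exists u, v, w. lia.
Qed.

Lemma complete_3_3_23 : complete [(1, 3); (1, 3); (2, 3)].
Proof.
intros N N0. apply rep3.
destruct (three_squares (4 * N + 2)) as (a & b & c & e); [lia|right; left; modlia|].
destruct (squares3_mod4_2 (fun _ => True) a b c N) as (x & y & z & _ & _ & _ & [i hi] & oy & h); auto.
destruct (odd_pgon_3 (x + 2 * z)) as [u hu]; [exists (i + z); lia|].
destruct (odd_pgon_3 (x - 2 * z)) as [v hv]; [exists (i - z); lia|].
destruct (odd_pgon_3 y oy) as [w hw].
exists u, v, w. lia.
Qed.

(** The roots are [X = 2 z + x'], [Y = y] and [W = (2 z - x')/3], since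
    [X^2 + 9 W^2 = 2 (x^2 + 4 z^2)]; the sign of [x'] makes [W] integral. *)
Lemma complete_5_25_33 : complete [(1, 5); (2, 5); (3, 3)].
Proof.
intros N N0. apply rep3.
destruct (three_squares_coprime3 (4 * N + 2) (12 * N + 6)) as (a & b & c & ha & hb & hc & e);
  [lia|lia|right; modlia|].
destruct (squares3_mod4_2 coprime3 a b c (3 * N + 1)) as (x & y & z & hx & hy & hz & ox & oy & h); auto; [lia|].
destruct (coprime3_sign (2 * z) x hz hx) as (x' & hx' & [i hi] & k & hk).
destruct (Z.Even_or_Odd x') as [[l hl]|[l hl]]; [destruct ox, hx'; exfalso; lia|].
(* [x' = 2 z - 3 k] is odd, so that [k] and [2 z + x'] are odd *)
destruct (odd_pgon_3 k) as [w hw]; [exists (z - l - k - 1); lia|].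
destruct (coprime6_pgon_5 (2 * z + x')) as [u hu].
{ exists (z + l). lia. }
{ destruct hi; [exists (2 * i + k + 1)|exists (2 * i + k - 1)]; lia. }
destruct (coprime6_pgon_5 y oy hy) as [v hv].
exists u, v, w. assert (x * x = x' * x') by (destruct hx'; subst; lia). lia.
Qed.

Lemma complete_5_5_45 : complete [(1, 5); (1, 5); (4, 5)].
Proof.
intros N N0. apply rep3.
destruct (three_squares_coprime3 (8 * N + 2) (24 * N + 6)) as (a & b & c & ha & hb & hc & e);
  [lia|lia|right; modlia|].
destruct (squares3_mod4_2 coprime3 a b c (6 * N + 1)) as (x & y & z & hx & hy & hz & ox & oy & h); auto; [lia|].
assert (oz : Z.Odd z).
{ destruct (odd_square x ox) as [i hi].
  destruct (odd_square y oy) as [j hj].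
  destruct (square_mod8 z) as [[oz _]|[(k & k' & _ & hk)|(k & k' & _ & hk)]]; [auto|exfalso; lia|exfalso; lia]. }
destruct (coprime6_pgon_5 x ox hx) as [u hu]. destruct (coprime6_pgon_5 y oy hy) as [v hv].
destruct (coprime6_pgon_5 z oz) as [w hw]; [destruct hz as [k hk]; exists (z - k); lia|].
exists u, v, w. lia.
Qed.

(** Odd squares are 1 or 9 modulo 16; a sum equal to 2 forces them to agree, hence [a] and [b] agree
    up to sign modulo 8. *)
Lemma odd_sign_mod8 a b k : Z.Odd a -> Z.Odd b -> a * a + b * b = 16 * k + 2 ->
  exists c j, (c = b \/ c = -b) /\ a = c + 8 * j.
Proof.
intros oa ob e. destruct (odd_sign a b oa ob) as (c & hc & [i hi] & j & hj).
destruct (Z.Even_or_Odd j) as [[l hl]|[l hl]]; [exists c, l; lia|].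
exfalso. assert (h : (c + 4 * j) * (c + 4 * j) + c * c = 16 * k + 2) by (destruct hc; subst; lia).
subst c j. assert (T : exists m, i * i + i = 2 * m).
{ destruct (Z.Even_or_Odd i) as [[m ->]|[m ->]]; [exists (2 * m * m + m)|exists (2 * m * m + 3 * m + 1)]; lia. }
destruct T as [m hm]. lia.
Qed.

(** The roots are [(x + y')/2], [z] and [(x - y')/8]; the last is why agreement modulo 8 is
    needed. *)
Lemma complete_3_23_24 : complete [(1, 3); (2, 3); (2, 4)].
Proof.
intros N N0. apply rep3.
destruct (three_squares (16 * N + 6)) as (a & b & c & e); [lia|right; left; modlia|].
destruct (squares3_mod4_2 (fun _ => True) a b c (4 * N + 1)) as (x & y & z & _ & _ & _ & ox & oy & h); auto; [lia|].
destruct (odd_square x ox) as [i hi].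
destruct (odd_square y oy) as [j hj].
destruct (square_mod8 z) as [[oz [k hk]]|[(k & k' & _ & hk)|(k & k' & _ & hk)]]; [|exfalso; lia|exfalso; lia].
destruct (odd_sign_mod8 x y (N - 2 * k) ox oy) as (y' & l & hy & hl); [lia|].
destruct (Z.Even_or_Odd y') as [[m hm]|[m hm]]; [destruct oy, hy; exfalso; lia|].
destruct (odd_pgon_3 (y' + 4 * l)) as [u hu]; [exists (m + 2 * l); lia|].
destruct (odd_pgon_3 z oz) as [v hv].
exists u, v, l. rewrite pgon_4.
assert (y * y = y' * y') by (destruct hy; subst; lia). subst x. lia.
Qed.

(* [X^2 + 2 Y^2 + 3 Z^2 = 2 (a^2 + b^2 + c^2) / 3] with [X = Y - c], [Y = (a + b + c)/3]
   and [Z = (a - b)/3]. *)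
Lemma complete_3_23_33 : complete [(1, 3); (2, 3); (3, 3)].
Proof.
intros N N0. apply rep3.
destruct (three_squares_coprime3 (4 * N + 3) (12 * N + 9)) as (a & b & c & ha & hb & hc & e);
  [lia|lia|left; modlia|].
destruct (squares3_mod4_1 coprime3 a b c (3 * N + 2)) as (x & y & z & hx & hy & hz & [i hi] & h); auto; [lia|].
destruct (coprime3_sign x (2 * y) hx hy) as (y1 & hy1 & _ & j & hj).
destruct (coprime3_sign x (2 * z) hx hz) as (z1 & hz1 & _ & k & hk).
assert (E : exists p q, y1 = 2 * p /\ z1 = 2 * q) by (destruct hy1, hz1; [exists y, z|exists y, (-z)|exists (-y), z|exists (-y), (-z)]; lia).
destruct E as (p & q & hp & hq).
destruct (odd_pgon_3 (x - j - k - z1)) as [u hu]; [exists (p + j + k - i - 1); lia|].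
destruct (odd_pgon_3 (x - j - k)) as [v hv]; [exists (p + j + q + k - i - 1); lia|].
destruct (odd_pgon_3 j) as [w hw]; [exists (i - p - j); lia|].
exists u, v, w.
assert (h' : x * x + y1 * y1 + z1 * z1 = 12 * N + 9) by (destruct hy1, hz1; subst y1 z1; lia).
assert (y1 = x - 3 * j) by lia. assert (z1 = x - 3 * k) by lia. clear hp hq hy1 hz1. subst y1 z1. lia.
Qed.

(* For [n = 2 mod 3] the signs can be chosen with [3 | a + b + c]; then [X = (a + b + c)/3],
   [Z = (a - b)/2] and [Y = (X - c)/2]. *)
Lemma squares3_362 a b c n k : a * a + b * b + c * c = n -> n = 3 * k + 2 ->
  (exists i, a = b + 2 * i) -> Z.Odd c ->
  exists X Y Z b', Z.Odd X /\ coprime3 Z /\ (b' = b \/ b' = -b) /\ a = b' + 2 * Z /\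
    3 * (X * X) + 6 * (Y * Y) + 2 * (Z * Z) = n.
Proof.
intros e hn [i hi] [j hj].
assert (H : exists b' c', (b' = b \/ b' = -b) /\ (c' = c \/ c' = -c) /\ exists X, a + b' + c' = 3 * X).
{ destruct (squares3_mod3_2 a b c k) as [(m & h & h1 & h2)|[(m & h & h1 & h2)|(m & h & h1 & h2)]]; [lia| | |].
  - destruct (coprime3_sign b c h1 h2) as (c' & hc & _ & l & hl).
    exists b, (-c'). split; [lia|]. split; [destruct hc; lia|]. exists (m + l). lia.
  - destruct (coprime3_sign a c h1 h2) as (c' & hc & _ & l & hl).
    exists b, (-c'). split; [lia|]. split; [destruct hc; lia|]. exists (m + l). lia.
  - destruct (coprime3_sign a b h1 h2) as (b' & hb & _ & l & hl).
    exists (-b'), c. split; [destruct hb; lia|]. split; [lia|]. exists (m + l). lia. }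
destruct H as (b' & c' & hb & hc & X & hX).
assert (hz : exists Z, a = b' + 2 * Z) by (destruct hb; [exists i|exists (b + i)]; lia).
destruct hz as [Z hZ].
assert (hc' : exists m, c' = 2 * m + 1) by (destruct hc; [exists j|exists (-j - 1)]; lia).
destruct hc' as [m hm].
assert (hY : X = c' + 2 * (b' + Z - X)) by lia.
set (Y := b' + Z - X) in *.
assert (E : 3 * (X * X) + 6 * (Y * Y) + 2 * (Z * Z) = n).
{ rewrite <- e. replace (b * b) with (b' * b') by (destruct hb; subst b'; ring).
  replace (c * c) with (c' * c') by (destruct hc; subst c'; ring).
  assert (hb' : b' = X + Y - Z) by (unfold Y; lia). assert (hc'' : c' = X - 2 * Y) by lia.
  rewrite hZ, hb', hc''. ring. }
exists X, Y, Z, b'. split; [exists (m + Y); lia|]. split; [|auto].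
destruct (square_mod3 Z) as [(u & v & hu & hv)|[h _]]; [exfalso; lia|exact h].
Qed.

Lemma complete_3_23_8 : complete [(1, 3); (2, 3); (1, 8)].
Proof.
intros N N0. apply rep3.
destruct (three_squares (24 * N + 17)) as (a & b & c & e); [lia|left; modlia|].
destruct (squares3_mod4_1 (fun _ => True) a b c (6 * N + 4)) as (z & x & y & _ & _ & _ & oz & h); auto; [lia|].
destruct (squares3_362 (2 * x) (2 * y) z (24 * N + 17) (8 * N + 5)) as (X & Y & Z & b' & oX & hZ & hb & hx & E);
  [lia|lia|exists (x - y); lia|exact oz|].
destruct (odd_square z oz) as [i hi].
(* Modulo 8, [z^2 + 4 (x^2 + y^2) = 24 N + 17] forces [x^2 + y^2] to be even, and [Z] is [x - y] or
   [x + y]. *)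
assert (H : exists k, Z = 2 * k).
{ destruct (Z.Even_or_Odd Z) as [[k hk]|[k hk]]; [exists k; exact hk|exfalso].
  assert (hxy : x = y + Z \/ x = Z - y) by lia.
  assert (h' : x * x = y * y + 2 * Z * y + Z * Z \/ x * x = y * y - 2 * Z * y + Z * Z) by (destruct hxy; [left|right]; subst x; ring).
  subst Z. lia. }
destruct H as [k hk].
assert (oY : Z.Odd Y).
{ destruct (odd_square X oX) as [j hj].
  destruct (square_mod8 Y) as [[h' _]|[(l & l' & _ & hl)|(l & l' & _ & hl)]]; [exact h'| |]; exfalso; subst Z; lia. }
assert (hk3 : coprime3 k) by (destruct hZ as [l hl]; exists (k - l); lia).
destruct (odd_pgon_3 X oX) as [u hu]. destruct (odd_pgon_3 Y oY) as [v hv].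
destruct (coprime3_pgon_8 k hk3) as [w hw].
exists u, v, w. subst Z. lia.
Qed.

Lemma three_squares_362 k : 0 <= k -> (2 * k + 1) mod 4 = 1 \/ (2 * k + 1) mod 8 = 3 -> (exists j, 2 * k + 1 = 3 * j + 2) ->
  exists X Y Z, Z.Odd X /\ coprime3 Z /\ 3 * (X * X) + 6 * (Y * Y) + 2 * (Z * Z) = 2 * k + 1.
Proof.
intros k0 hk [j hj].
destruct (three_squares (2 * k + 1)) as (a & b & c & e); [lia|tauto|].
assert (H : exists x y z, x * x + y * y + z * z = 2 * k + 1 /\ (exists i, x = y + 2 * i) /\ Z.Odd z).
{ destruct hk as [hk|hk].
  - destruct (squares3_mod4_1 (fun _ => True) a b c ((2 * k + 1)/4)) as (z & x & y & _ & _ & _ & oz & h); auto; [modlia|].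
    exists (2 * x), (2 * y), z. split; [modlia|]. split; [exists (x - y); lia|exact oz].
  - destruct (squares3_mod8_3 a b c ((2 * k + 1)/8)) as ([x hx] & [y hy] & hz); [modlia|].
    exists a, b, c. split; [lia|]. split; [exists (x - y); lia|exact hz]. }
destruct H as (x & y & z & h & hxy & oz).
destruct (squares3_362 x y z (2 * k + 1) j h hj hxy oz) as (X & Y & Z & b' & oX & hZ & _ & _ & E).
exists X, Y, Z. auto.
Qed.

Lemma complete_43_4_8 c : c = 1 \/ c = 2 \/ c = 3 -> complete [(4, 3); (1, 4); (1, 8); (c, 8)].
Proof.
intros hc N N0. apply rep4.
(* [W = 1] and [W = 2] give [p_8] the values 0 and 1. The number [6 N + 5] is 7 modulo 8 exactly
   when [N] is 3 modulo 4; subtracting [6 c] then gives 1, 3 or 5 modulo 8 for [c] equal to 1, 2 or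
   3. *)
assert (H : exists W k, coprime3 W /\ 0 <= k /\ ((2 * k + 1) mod 4 = 1 \/ (2 * k + 1) mod 8 = 3) /\
  6 * N + 5 + 2 * c - 2 * c * (W * W) = 2 * k + 1).
{ assert (hN : N mod 4 <> 3 \/ N mod 4 = 3) by lia. destruct hN as [hN|hN].
  - exists 1, (3 * N + 2). split; [exists 0; lia|]. split; [lia|]. split; [modlia|lia].
  - exists 2, (3 * N + 2 - 3 * c). split; [exists 1; lia|]. split; [modlia|]. split; [|lia].
    destruct hc as [->|[->| ->]]; modlia. }
destruct H as (W & k & hW & k0 & hk & E).
destruct (square_mod3 W) as [(l & l' & hl & _)|[_ [l hl]]]; [destruct hW; exfalso; lia|].
destruct (three_squares_362 k k0 hk) as (X & Y & Z & oX & hZ & h); [rewrite hl in E; exists (2 * N + 1 - 2 * c * l); lia|].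
destruct (odd_pgon_3 X oX) as [u hu]. destruct (coprime3_pgon_8 Z hZ) as [v hv].
destruct (coprime3_pgon_8 W hW) as [w hw].
exists u, Y, v, w. rewrite pgon_4.
assert (c * (3 * pgon 8 w + 1) = c * (W * W)) by (f_equal; exact hw). lia.
Qed.

(* [m] is a sum [u^2 + s^2 + 2 p^2]; two of the three terms that are divisible by 3 can be
   replaced using [norm2_coprime3], unless both vanish. *)
Lemma nonsquare_124 k : 0 <= k -> (forall u, Z.Odd u -> u * u <> 6 * k + 1) ->
  exists X Y Z, Z.Odd X /\ coprime3 X /\ coprime3 Y /\ coprime3 Z /\
    X * X + 2 * (Y * Y) + 4 * (Z * Z) = 6 * k + 1.
Proof.
intros k0 hns.
destruct (three_squares (12 * k + 2)) as (a & b & c & e); [lia|right; left; modlia|].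
destruct (squares3_mod4_2 (fun _ => True) a b c (3 * k)) as (x & y & p & _ & _ & _ & ox & oy & h); auto; [lia|].
destruct (odd_sign x y ox oy) as (y' & hy & [j hj] & s & hs).
assert (e1 : (y' + 2 * s) * (y' + 2 * s) + 4 * (s * s) + 2 * (p * p) = 6 * k + 1).
{ assert (hyy : y * y = y' * y') by (destruct hy; subst y'; ring). subst x. lia. }
assert (ou : exists v, y' + 2 * s = 2 * v + 1) by (exists (j + s); lia).
set (u := y' + 2 * s) in *. clearbody u. clear x y y' ox oy hy hs h j hj a b c e.
destruct ou as [v hv].
assert (C2 : forall x, coprime3 (2 * x) -> coprime3 x) by (intros x [l hl]; exists (x - l); lia).
destruct (square_mod3 u) as [(u1 & i & hu & hu2)|(hu & i & hi)];
destruct (square_mod3 s) as [(s1 & l & hs & hs2)|(hs & l & hl)];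
destruct (square_mod3 p) as [(p1 & r & hp & hp2)|(hp & r & hr)]; try (exfalso; lia).
- assert (u * u = 4 * (v * v + v) + 1) by (rewrite hv; ring).
  pose proof (Z.square_nonneg u). pose proof (Z.square_nonneg p).
  destruct (norm2_coprime3 (S (Z.to_nat (3 * i + 6 * r))) u p (3 * i + 6 * r)) as (u' & p' & hu' & hp' & E); [lia|lia|lia|].
  destruct (Z.Even_or_Odd u') as [[w hw]|ou]; [subst u u'; exfalso; lia|].
  exists u', p', s. repeat split; auto. lia.
- assert (D : s1 = 0 /\ p1 = 0 \/ 0 < 12 * l + 6 * r).
  { destruct (Z.eq_dec s1 0), (Z.eq_dec p1 0); [left; auto|right|right|right]; subst s p; nia. }
  destruct D as [[hs0 hp0]|D].
  { exfalso. apply (hns u); [exists v; exact hv|]. subst; lia. }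
  destruct (norm2_coprime3 (S (Z.to_nat (12 * l + 6 * r))) (2 * s) p (12 * l + 6 * r)) as (s' & p' & hs' & hp' & E); [lia|lia|lia|].
  destruct (Z.Even_or_Odd s') as [[w hw]|[w hw]]; [|subst s'; exfalso; lia].
  exists u, p', w. split; [exists v; exact hv|]. repeat split; auto; [apply C2; subst s'; exact hs'|subst s'; lia].
- exists u, p, s. split; [exists v; exact hv|]. repeat split; auto. lia.
Qed.


(* [6 N + 7] and [6 N + 7 - 6 c] are not both odd squares, as [8] does not divide [6 c]. *)
Lemma represented_124 c N : 0 < c <= 6 -> c mod 4 <> 0 -> 0 <= N ->
  exists W k, (W = 1 \/ W = 2) /\ 6 * N + 7 + 2 * c - 2 * c * (W * W) = 6 * k + 1 /\
  exists X Y Z, Z.Odd X /\ coprime3 X /\ coprime3 Y /\ coprime3 Z /\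
    X * X + 2 * (Y * Y) + 4 * (Z * Z) = 6 * k + 1.
Proof.
intros hc hc4 N0.
assert (S : (forall u, Z.Odd u -> u * u <> 6 * (N + 1) + 1) \/ exists u, Z.Odd u /\ 0 <= u /\ u * u = 6 * (N + 1) + 1).
{ set (m := 6 * (N + 1) + 1). destruct (Z.eq_dec (Z.sqrt m * Z.sqrt m) m) as [h|h].
  - right. exists (Z.sqrt m). split; [|split; [apply Z.sqrt_nonneg|exact h]].
    destruct (Z.Even_or_Odd (Z.sqrt m)) as [[i hi]|o]; [|exact o]. rewrite hi in h. unfold m in h. lia.
  - left. intros u _ hu. apply h. replace m with (u * u) by exact hu.
    assert (e : u * u = Z.abs u * Z.abs u) by (destruct (Z.abs_spec u) as [[_ ->]|[_ ->]]; ring).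
    rewrite e at 1 2. rewrite Z.sqrt_square by lia. lia. }
destruct S as [S|(u & [v hv] & u0 & hu)].
- exists 1, (N + 1). split; [lia|]. split; [lia|]. apply nonsquare_124; [lia|exact S].
- assert (v2 : v = 2 \/ 3 <= v).
  { assert (v = 0 \/ v = 1 \/ v = 2 \/ 3 <= v) as [?|[?|[?|?]]] by lia; subst; lia. }
  (* For [u = 5] the number [25 - 6 c] may be negative, but [25 = 1 + 2 * 4 + 4 * 4] serves
     directly. For [u >= 7] one has [N + 1 >= 8 > c]. *)
  destruct v2 as [->|v3].
  + exists 1, 4. split; [lia|]. split; [lia|]. exists 1, 2, 2.
    split; [exists 0; lia|]. split; [exists 0; lia|]. split; [exists 1; lia|]. split; [exists 1; lia|lia].
  + exists 2, (N + 1 - c). split; [lia|]. split; [lia|]. apply nonsquare_124; [nia|].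
    intros w ow hw. destruct (odd_square w ow) as [i hi].
    destruct (odd_square u) as [j hj]; [exists v; exact hv|]. modlia.
Qed.

Lemma complete_45_8_28 c : 0 < c <= 6 -> c mod 4 <> 0 -> complete [(4, 5); (1, 8); (2, 8); (c, 8)].
Proof.
intros hc hc4 N N0. apply rep4.
destruct (represented_124 c N hc hc4 N0) as (W & k & hW & E & X & Y & Z & oX & hX & hY & hZ & h).
destruct (coprime6_pgon_5 X oX hX) as [x hx]. destruct (coprime3_pgon_8 Y hY) as [y hy].
destruct (coprime3_pgon_8 Z hZ) as [z hz].
destruct (coprime3_pgon_8 W) as [w hw]; [destruct hW; [exists 0|exists 1]; lia|].
exists x, y, z, w.
assert (c * (3 * pgon 8 w + 1) = c * (W * W)) by (f_equal; exact hw). lia.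
Qed.

(** Only the values 0 and 1 of the last term are used, and [p_4] takes them as well as [p_8]. *)
Lemma complete_45_8_28_34 : complete [(4, 5); (1, 8); (2, 8); (3, 4)].
Proof.
intros N N0. apply rep4.
destruct (represented_124 3 N) as (W & k & hW & E & X & Y & Z & oX & hX & hY & hZ & h); [lia|modlia|lia|].
destruct (coprime6_pgon_5 X oX hX) as [x hx]. destruct (coprime3_pgon_8 Y hY) as [y hy].
destruct (coprime3_pgon_8 Z hZ) as [z hz].
exists x, y, z, (W - 1). rewrite pgon_4. destruct hW; subst W; lia.
Qed.

(** * Derivation of all chains by computation *)

Lemma rules_sound r : In r [rule_5_8; rule_45_8; rule_5_25; rule_33_5; rule_3_5; rule_3_3] ->
  sound r /\ sound (opposite r).
Proof.
intros [<-|[<-|[<-|[<-|[<-|[<-|[]]]]]]].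
- exact (conj sound_5_8 sound_5_8_opposite).
- exact (conj sound_45_8 sound_45_8_opposite).
- exact (conj sound_5_25 sound_5_25_opposite).
- exact (conj sound_33_5 sound_33_5_opposite).
- exact (conj sound_3_5 sound_3_5_opposite).
- exact (conj sound_3_3 sound_3_3_opposite).
Qed.

Definition rules : list rule :=
  [rule_5_8; opposite rule_5_8; rule_45_8; opposite rule_45_8; rule_5_25; opposite rule_5_25;
   rule_33_5; opposite rule_33_5; rule_3_5; opposite rule_3_5; rule_3_3; opposite rule_3_3].

Definition known : list form :=
  [[(2, 5); (1, 8); (1, 8)]; [(1, 5); (2, 5); (1, 8)]; [(1, 3); (2, 3); (4, 3)];
   [(1, 3); (1, 3); (2, 3)]; [(1, 5); (2, 5); (3, 3)]; [(1, 5); (1, 8); (1, 8)];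
   [(1, 3); (2, 3); (3, 3)]; [(1, 5); (1, 5); (4, 5)]; [(1, 3); (2, 3); (2, 4)];
   [(1, 5); (2, 5); (4, 5); (2, 8)]; [(1, 8); (2, 5); (4, 5); (2, 8)]; [(1, 8); (2, 5); (2, 8); (2, 8)];
   [(4, 3); (1, 4); (1, 8); (1, 8)]; [(4, 3); (1, 4); (1, 8); (2, 8)]; [(4, 3); (1, 4); (1, 8); (3, 8)];
   [(4, 5); (1, 8); (2, 8); (2, 8)]; [(4, 5); (1, 8); (2, 8); (3, 8)]; [(4, 5); (1, 8); (2, 8); (5, 8)];
   [(4, 5); (1, 8); (2, 8); (6, 8)]; [(4, 5); (1, 8); (2, 8); (3, 4)];
   [(1, 3); (6, 3); (1, 4); (1, 5)]].

Definition sum_form (F : qsum) : form := [(ca F, ra F); (cb F, rb F); (cc F, rc F); (cd F, rd F)].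

(** Members of the chain that contain a known universal subsum are the seeds. All intermediate sums
    are again members of the chain, so the search never leaves it. *)
Definition derivable (ch : list qsum) : bool :=
  let '(base, rest) := partition (fun F => existsb (fun K => extends K F) known) (map sum_form ch) in
  saturates 6 rules base rest.

Lemma known_complete : Forall complete known.
Proof.
assert (h1 : complete [(1, 5); (1, 8); (1, 8)]).
{ apply (rewrites_complete [(1, 3); (2, 3); (1, 8)] _ 1 (opposite rule_5_8));
  [apply sound_5_8_opposite|reflexivity|apply complete_3_23_8]. }
(* The derivation of this sum passes through sums outside its own chain, hence it is made a seed. *)
assert (h2 : complete [(1, 3); (6, 3); (1, 4); (1, 5)]).
{ apply (rewrites_complete [(6, 3); (1, 5); (1, 5); (2, 5)] _ 1 rule_5_25); [apply sound_5_25|reflexivity|].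
  apply (rewrites_complete [(1, 5); (1, 5); (4, 5); (2, 8)] _ 2 (opposite rule_33_5));
  [apply sound_33_5_opposite|reflexivity|].
  apply (extends_complete [(1, 5); (1, 5); (4, 5)]); [reflexivity|apply complete_5_5_45]. }
unfold known. repeat apply Forall_cons; try apply Forall_nil; try assumption.
- exact complete_25_8_8.
- exact complete_5_25_8.
- exact complete_3_23_43.
- exact complete_3_3_23.
- exact complete_5_25_33.
- exact complete_3_23_33.
- exact complete_5_5_45.
- exact complete_3_23_24.
- exact (complete_double _ 5 erefl complete_5_25_8).
- exact (complete_double _ 8 erefl complete_5_25_8).
- exact (complete_double _ 8 erefl h1).
- apply complete_43_4_8; lia.
- apply complete_43_4_8; lia.
- apply complete_43_4_8; lia.
- apply complete_45_8_28; [lia|discriminate].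
- apply complete_45_8_28; [lia|discriminate].
- apply complete_45_8_28; [lia|discriminate].
- apply complete_45_8_28; [lia|discriminate].
- exact complete_45_8_28_34.
Qed.

Lemma derivable_complete ch F : derivable ch = true -> In F ch -> complete (sum_form F).
Proof.
unfold derivable.
set (f := fun F => existsb (fun K => extends K F) known).
destruct (partition f (map sum_form ch)) as [base rest] eqn:e. intros h hF.
assert (hb : Forall complete base).
{ apply Forall_forall. intros G hG. pose proof (partition_as_filter f (map sum_form ch)) as p.
  rewrite e in p. injection p as -> _. apply filter_In in hG. destruct hG as [_ hG].
  apply existsb_exists in hG. destruct hG as (K & hK & hG).
  apply (extends_complete K); [exact hG|]. pose proof known_complete as k. rewrite Forall_forall in k. auto. }
assert (hr : Forall sound rules).
{ assert (R : forall r, In r rules -> sound r).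
  { intros r. unfold rules. intros hr.
    repeat (destruct hr as [<-|hr]; [first [apply rules_sound; cbn; tauto|apply (proj2 (rules_sound _ ltac:(cbn; eauto 10)))]|]).
    destruct hr. }
  apply Forall_forall. exact R. }
pose proof (saturates_complete _ _ hr _ _ h hb) as ht.
rewrite Forall_forall in hb, ht.
destruct (proj1 (elements_in_partition _ _ e (sum_form F)) (in_map _ _ _ hF)); auto.
Qed.

Lemma represents_rep F N : represents F N <-> rep (sum_form F) N.
Proof. unfold sum_form. rewrite rep4. reflexivity. Qed.

Definition positive (F : qsum) : bool := forallb (fun t => andb (0 <=? fst t) (3 <=? snd t)) (sum_form F).

Lemma represents_nonneg F N : positive F = true -> represents F N -> 0 <= N.
Proof.
intros hF h. apply represents_rep in h. unfold positive in hF. revert N h hF.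
induction (sum_form F) as [|[c r] G IH]; cbn; intros N.
- lia.
- intros [x h] hF. apply andb_prop in hF. destruct hF as [h1 h2]. apply andb_prop in h1. destruct h1 as [hc hr].
  apply Z.leb_le in hc, hr. cbn in hc, hr. pose proof (IH _ h h2). pose proof (pgon_nonneg r x hr). nia.
Qed.

Theorem theorem3p4 :
  forall ch : list qsum, In ch chains ->
    (forall F G : qsum, In F ch -> In G ch -> equivalent F G) /\
    (forall F : qsum, In F ch -> universal F).
Proof.
intros ch hch.
assert (U : forall F, In F ch -> universal F).
{ intros F hF N. split.
  - apply represents_nonneg.
    assert (P : forallb (forallb positive) chains = true) by (vm_compute; reflexivity).
    rewrite forallb_forall in P. specialize (P ch hch). rewrite forallb_forall in P. auto.
  - intros N0. apply represents_rep.
    assert (D : forallb derivable chains = true) by (vm_compute; reflexivity).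
    rewrite forallb_forall in D. apply (derivable_complete ch F (D ch hch) hF N N0). }
split; [|exact U].
intros F G hF hG N. rewrite (U F hF N), (U G hG N). reflexivity.
Qed.
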